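(* Let $a<b$, $N\ge 2$, and let $a=x_0<x_1<\cdots<x_N=b$ be an arbitrary partition of $[a,b]$. Set $h_\ell=x_\ell-x_{\ell-1}$ for $1\le \ell\le N$ and $d_\iota^\ell=|x_\iota-x_\ell|$ for $0\le \iota,\ell\le N$. For $1\le j\le N-1$ let $\phi_j$ be the hat function on $\mathbb{R}$ given by $\phi_j(x)=(x-x_{j-1})/h_j$ for $x\in(x_{j-1},x_j)$, $\phi_j(x)=(x_{j+1}-x)/h_{j+1}$ for $x\in(x_j,x_{j+1})$, and $\phi_j(x)=0$ elsewhere on $\mathbb{R}$. For $0<s<3/2$ define $$S_{jk}=\int_{\mathbb{R}}|\xi|^{2s}\,\mathscr{F}[\phi_j](\xi)\,\overline{\mathscr{F}[\phi_k](\xi)}\,d\xi,\qquad 1\le j,k\le N-1,$$ where $\mathscr F[u](\xi)=\frac{1}{\sqrt{2\pi}}\int_{\mathbb R}u(x)e^{-\mathrm{i}x\xi}\,dx$. For $1\le l\le N-1$ let $\mathbf c_l=\big(\tfrac1{h_l},\,-\tfrac1{h_l}-\tfrac1{h_{l+1}},\,\tfrac1{h_{l+1}}\big)$ (a row vector). (i) If $s\in(0,3/2)$ and $s\neq 1/2$, then with $\gamma=3-2s$, $$S_{jk}=\widehat C_s\,\mathbf c_j\,\mathbf D_j^k\,\mathbf c_k^{t},\qquad \widehat C_s=\frac{1}{2\,\Gamma(4-2s)\cos(s\pi)},$$ where $\mathbf D_j^k$ is the $3\times 3$ matrix whose $(p,q)$ entry, for $p,q\in\{-1,0,1\}$ (rows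 indexed by $p$, columns by $q$, in the order $-1,0,1$), is $(d_{j+p}^{k+q})^{\gamma}$. (ii) If $s=1/2$, then $$S_{jk}=\frac{1}{2\pi}\,\mathbf c_j\,\mathbf E_j^k\,\mathbf c_k^{t},$$ where $\mathbf E_j^k$ is the $3\times3$ matrix whose $(p,q)$ entry, $p,q\in\{-1,0,1\}$ in the same order, is $(d_{j+p}^{k+q})^2\ln d_{j+p}^{k+q}$, with the convention that this entry is $0$ when $d_{j+p}^{k+q}=0$.
   Context: The quantity $S_{jk}$ is the $(j,k)$ entry of the piecewise-linear finite element stiffness matrix for the integral fractional Laplacian $(-\Delta)^s u=\mathscr F^{-1}[|\xi|^{2s}\mathscr F[u]]$ with homogeneous Dirichlet exterior condition on $\Omega=(a,b)$, i.e. $S_{jk}=\int_{\mathbb R}((-\Delta)^{s/2}\phi_j)((-\Delta)^{s/2}\phi_k)\,dx$. $\mathbf c_k^t$ denotes the transpose (column vector). *)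

(* Defs.v *)
From mathcomp Require Import all_boot all_algebra.
From mathcomp Require Import complex.
From mathcomp Require Import all_classical all_reals all_analysis.

Import GRing.Theory Num.Theory.

Set Implicit Arguments.
Unset Strict Implicit.
Unset Printing Implicit Defensive.

Local Open Scope ring_scope.
Local Open Scope complex_scope.

Section Defs.
Variable R : realType.

Definition cint (f : R -> R[i]) : R[i] :=
  (Rintegral lebesgue_measure [set: R] (fun t => complex.Re (f t)))
  +i* (Rintegral lebesgue_measure [set: R] (fun t => complex.Im (f t))).

Definition cexpi (th : R) : R[i] := (cos th) +i* (sin th).

Definition fourier (u : R -> R) (xi : R) : R[i] :=
  ((Num.sqrt (2 * pi))^-1)%:C * cint (fun t => (u t)%:C * cexpi (- (t * xi))).

Definition Gamma (z : R) : R :=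
  Rintegral lebesgue_measure `]0, +oo[%classic (fun t => t `^ (z - 1) * expR (- t)).

Variable x : nat -> R.   (* the nodes x_0 < ... < x_N *)

Definition h (l : nat) : R := x l - x l.-1.

Definition d (i l : nat) : R := `| x i - x l |.

Definition hat (j : nat) (t : R) : R :=
  if (x j.-1 < t) && (t < x j) then (t - x j.-1) / h j
  else if (x j < t) && (t < x j.+1) then (x j.+1 - t) / h j.+1
  else 0.

Definition S (s : R) (j k : nat) : R[i] :=
  cint (fun xi => (`|xi| `^ (2 * s))%:C * fourier (hat j) xi
                    * conjc (fourier (hat k) xi)).

(* c_l = (1/h_l, -1/h_l - 1/h_{l+1}, 1/h_{l+1}) as a row vector;
   index 0,1,2 of 'I_3 corresponds to -1,0,1 *)
Definition cvec (l : nat) : 'rV[R]_3 :=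
  \row_(i < 3) [:: (h l)^-1; - (h l)^-1 - (h l.+1)^-1; (h l.+1)^-1]`_i.

(* D_j^k : (p,q) entry (d_{j+p}^{k+q})^gamma, p,q in {-1,0,1} <-> 0,1,2 *)
Definition Dmx (gam : R) (j k : nat) : 'M[R]_3 :=
  \matrix_(p < 3, q < 3) (d (j + p).-1 (k + q).-1) `^ gam.

Definition Emx (j k : nat) : 'M[R]_3 :=
  \matrix_(p < 3, q < 3)
    (let e := d (j + p).-1 (k + q).-1 in if e == 0 then 0 else e ^+ 2 * ln e).

Definition Chat (s : R) : R := (2 * Gamma (4 - 2 * s) * cos (s * pi))^-1.

End Defs.

(* Main.v *)
Require Import Defs.
From mathcomp Require Import all_boot all_order all_algebra.
From mathcomp Require Import complex ring lra.
From mathcomp Require Import all_classical all_reals all_analysis.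
From mathcomp Require Import measurable_realfun.

(** Off [xi = 0] the Fourier transform of a hat function is
    [- xi^-2 (sum_p c_p e^(- i x_p xi)) / sqrt (2 pi)], so, with [gamma = 3 - 2 s],
    [pi S_jk] is the integral over [xi > 0] of [xi^(- gamma - 1) sum w cos (d xi)],
    where the weights [w = c_p c_q] and the distances [d = |x_p - x_q|] satisfy
    [sum w = sum w d^2 = 0].  These relations allow [cos (d xi)] to be replaced by
    [cos (d xi) - 1] if [gamma < 2], by [cos (d xi) - 1 + d^2 xi^2 / 2] if [gamma > 2]
    and by [cos (d xi) - 1 - d^2 (cos xi - 1)] if [gamma = 2], after which every
    term is integrable.  Writing [Gamma (gamma + 1) xi^(- gamma - 1)] as the
    integral of [t^gamma e^(- t xi)] and exchanging the integrals leaves, in the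
    first two cases, the Mellin transform of [1 / (t^2 + d^2)], i.e. the value
    [pi / (2 sin (pi a / 2))] of the integral of [t^(a-1) / (1 + t^2)], and in the
    third case an elementary logarithmic integral.  That Mellin transform is
    obtained from the Herglotz argument: an integral whose value is expected to be
    [1/b - (pi/2) cot (pi b/2)] satisfies the duplication formula of this function,
    and the duplication formula together with an [O(b)] bound has a unique solution. *)

Import Order.TTheory GRing.Theory Num.Theory.
Import numFieldNormedType.Exports.

Local Open Scope classical_set_scope.
Local Open Scope ring_scope.

(** * Measurability of elementary functions *)

Section measurability.
Context {R : realType}.

Lemma measurable_inv : measurable_fun [set: R] (@GRing.inv R).
Proof.
have -> : @GRing.inv R = fun x => x * (x ^+ 2) `^ (-1).
  apply/funext => x; rewrite powR_inv1 ?sqr_ge0//.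
  have [->|x0] := eqVneq x 0; first by rewrite invr0 mul0r.
  by field.
apply: measurable_funM => //.
exact: (measurableT_comp (measurable_powR (-1))).
Qed.

Lemma measurable_funV d (T : measurableType d) (D : set T) (f : T -> R) :
  measurable_fun D f -> measurable_fun D (fun x => (f x)^-1).
Proof. exact: measurableT_comp measurable_inv. Qed.

Lemma measurable_fun_expR d (T : measurableType d) (D : set T) (f : T -> R) :
  measurable_fun D f -> measurable_fun D (fun x => expR (f x)).
Proof. exact: measurableT_comp (@measurable_expR R). Qed.

Lemma measurable_fun_powR d (T : measurableType d) (D : set T) (f : T -> R) p :
  measurable_fun D f -> measurable_fun D (fun x => f x `^ p).
Proof. exact: measurableT_comp (measurable_powR p). Qed.

Lemma measurable_fun_sin d (T : measurableType d) (D : set T) (f : T -> R) :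
  measurable_fun D f -> measurable_fun D (fun x => sin (f x)).
Proof.
apply: measurableT_comp; apply: continuous_measurable_fun.
exact: continuous_sin.
Qed.

Lemma measurable_fun_cos d (T : measurableType d) (D : set T) (f : T -> R) :
  measurable_fun D f -> measurable_fun D (fun x => cos (f x)).
Proof.
apply: measurableT_comp; apply: continuous_measurable_fun.
exact: continuous_cos.
Qed.

End measurability.

Ltac meas :=
  repeat match goal with
  | |- measurable_fun _ (fun _ => _%:E) => apply/measurable_EFinP => /=
  | |- measurable_fun _ (EFin \o _) => apply/measurable_EFinP => /=
  | |- measurable_fun _ (fun x => x) => exact: measurable_id
  | |- measurable_fun _ (fun x => fst x) => exact: measurable_fst
  | |- measurable_fun _ (fun x => snd x) => exact: measurable_snd
  | |- measurable_fun _ (fun _ => ?c) => exact: measurable_cst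
  | |- measurable_fun _ (fun _ => _ + _) => apply: measurable_funD
  | |- measurable_fun _ (fun _ => - _) => apply: measurable_funN
  | |- measurable_fun _ (fun _ => _ * _) => apply: measurable_funM
  | |- measurable_fun _ (fun _ => _^-1) => apply: measurable_funV
  | |- measurable_fun _ (fun _ => _ ^+ _) => apply: measurable_funX
  | |- measurable_fun _ (fun _ => expR _) => apply: measurable_fun_expR
  | |- measurable_fun _ (fun _ => _ `^ _) => apply: measurable_fun_powR
  | |- measurable_fun _ (fun _ => sin _) => apply: measurable_fun_sin
  | |- measurable_fun _ (fun _ => cos _) => apply: measurable_fun_cos
  | |- measurable_fun _ (fun _ => `| _ |) => apply: measurableT_comp
  end.

(** * Dilations and reflection for Lebesgue measure *)

Section scaling.
Context {R : realType}.
Local Notation mu := (@lebesgue_measure R).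
Local Notation Rp := (`]0%R, +oo[%classic : set R).

Local Open Scope ereal_scope.

(** By uniqueness of Lebesgue measure: [c] times the pushforward of [mu] by [t -> c t] gives
    half-open intervals their length. *)
Lemma lebesgue_measure_scale (c : R) (A : set R) : (0 < c)%R -> measurable A ->
  mu ((fun t => c * t)%R @^-1` A) = c^-1%:E * mu A.
Proof.
move=> c0 mA.
have mc : measurable_fun [set: measurableTypeR R] 
    (fun t : measurableTypeR R => (c * t)%R : measurableTypeR R).
  by meas.
pose phi : measurableTypeR R -> measurableTypeR R := (fun t => c * t)%R.
have c0' : (0 <= c)%R by exact: ltW.
pose r := NngNum c0'.
pose nu : {measure set (measurableTypeR R) -> \bar R} := mscale r (pushforward mu phi).
have -> : mu A = nu mc A.
  move: A mA; apply: lebesgue_measure_unique.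
  move=> _ [[a b]] _ <-.
  rewrite /nu /= /mscale /pushforward /=.
  rewrite [X in _ * mu X](_ : _ = `](a / c)%R, (b / c)%R]%classic); last first.
    by apply/seteqP; split => x /=; rewrite !in_itv/= ltr_pdivrMr// ler_pdivlMr//
      /phi (mulrC c).
  rewrite !lebesgue_measure_itv/= !lte_fin ltr_pM2r ?invr_gt0//.
  case: ifPn => _; last by rewrite mule0.
  rewrite -!EFinB -EFinM; congr EFin.
  by rewrite -mulrBl mulrCA divff ?mulr1// gt_eqF.
by rewrite /nu /= /mscale /= muleA -EFinM mulVf ?gt_eqF// mul1e.
Qed.

(** The pushforward of [mu] by [t -> c t] is [c^-1 mu], and the half-line is its own preimage
    because [c] is positive. *)
Lemma ge0_integral_scale (c : R) (f : R -> \bar R) : (0 < c)%R ->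
  measurable_fun Rp f -> (forall t, (0 < t)%R -> 0 <= f t) ->
  \int[mu]_(t in Rp) f (c * t)%R =
  c^-1%:E * \int[mu]_(t in Rp) f t.
Proof.
move=> c0 mf f0.
have mc : measurable_fun [set: measurableTypeR R] 
    (fun t : measurableTypeR R => (c * t)%R : measurableTypeR R).
  by meas.
have ci0 : (0 <= c^-1)%R by rewrite invr_ge0 ltW.
have f0' : {in Rp, forall y, 0 <= f y}.
  by move=> y; rewrite inE/= in_itv/= andbT => y0; exact: f0.
rewrite -(@ge0_integral_mscale _ _ R mu _ (measurable_itv _) (NngNum ci0))//; last first.
  by move=> x Dx; apply: f0'; rewrite inE.
transitivity (\int[pushforward mu (fun t : measurableTypeR R => (c * t)%R : measurableTypeR R)]_(t in Rp) f t).
  rewrite ge0_integral_pushforward//.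
  congr (integral mu _ _).
  by apply/seteqP; split => x /=; rewrite !in_itv/= !andbT pmulr_rgt0.
apply: eq_measure_integral => A mA _.
exact: (lebesgue_measure_scale _ _ c0 mA).
Qed.

Lemma ge0_integral_reflect (f : R -> \bar R) :
  measurable_fun [set: R] f -> (forall t, 0 <= f t) ->
  \int[mu]_t f (- t)%R = \int[mu]_t f t.
Proof.
move=> mf f0.
transitivity (\int[pushforward mu (-%R : _ -> measurableTypeR R)]_t f t).
  rewrite (@ge0_integral_pushforward _ _ (measurableTypeR R) (measurableTypeR R) R)//.
by apply: eq_measure_integral => A mA _; exact: lebesgue_measureN.
Qed.

End scaling.

(** * The substitution [t = e^y] and folding of the line onto the half-line *)

Section expR_substitution.
Context {R : realType}.
Local Notation mu := (@lebesgue_measure R).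
Local Notation Rp := (`]0%R, +oo[%classic : set R).

Lemma ge0_integralD_pos (f g : R -> R) : measurable_fun Rp f -> measurable_fun Rp g ->
  (forall t : R, 0 < t -> 0 <= f t) -> (forall t : R, 0 < t -> 0 <= g t) ->
  (\int[mu]_(t in Rp) (f t)%:E + \int[mu]_(t in Rp) (g t)%:E =
   \int[mu]_(t in Rp) (f t + g t)%:E)%E.
Proof.
move=> mf mg f0 g0; rewrite -ge0_integralD//.
- by move=> t /=; rewrite in_itv/= andbT => t0; rewrite lee_fin f0.
- exact/measurable_EFinP.
- by move=> t /=; rewrite in_itv/= andbT => t0; rewrite lee_fin g0.
- exact/measurable_EFinP.
Qed.

Lemma ge0_integralZ_pos (c : R) (f : R -> R) : 0 <= c -> measurable_fun Rp f ->
  (forall t : R, 0 < t -> 0 <= f t) ->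
  (c%:E * \int[mu]_(t in Rp) (f t)%:E = \int[mu]_(t in Rp) (c * f t)%:E)%E.
Proof.
move=> c0 mf f0; rewrite -ge0_integralZl_EFin//.
- by move=> t /=; rewrite in_itv/= andbT => t0; rewrite lee_fin f0.
- exact/measurable_EFinP.
Qed.

Lemma eq_integral_pos (f g : R -> R) : (forall t : R, 0 < t -> f t = g t) ->
  (\int[mu]_(t in Rp) (f t)%:E = \int[mu]_(t in Rp) (g t)%:E)%E.
Proof.
move=> fg; apply: eq_integral => t; rewrite inE/= in_itv/= andbT => t0.
by rewrite fg.
Qed.

Lemma derive1_expR : derive1 (@expR R) = expR.
Proof. by apply/funext => x; rewrite derive1E derive_val. Qed.

Lemma pos_within_continuous (G : R -> R) (a b : R) : 0 < a ->
  (forall t : R, 0 < t -> {for t, continuous G}) -> {within `[a, b], continuous G}.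
Proof.
move=> a0 cG; apply: continuous_in_subspaceT => t.
by rewrite inE/= in_itv/= => /andP[at_ _]; apply: cG; exact: lt_le_trans at_.
Qed.

Lemma measurable_fun_continuous_pos (G : R -> R) :
  (forall t : R, 0 < t -> {for t, continuous G}) -> measurable_fun Rp G.
Proof.
move=> cG; apply: open_continuous_measurable_fun; first exact: interval_open.
by move=> t; rewrite inE/= in_itv/= andbT => t0; exact: cG.
Qed.

(** The substitution holds on the compact intervals [[e^(-i), e^i]], the images of [[-i, i]]; both
    sides then pass to the limit by monotone convergence along these exhaustions. *)
Lemma ge0_integral_expR_subst (G : R -> R) :
  (forall t : R, 0 < t -> {for t, continuous G}) -> (forall t : R, 0 < t -> 0 <= G t) ->
  (\int[mu]_(t in Rp) (G t)%:E = \int[mu]_y (G (expR y) * expR y)%:E)%E.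
Proof.
move=> cG G0.
have mG := measurable_fun_continuous_pos _ cG.
have cH y : {for y, continuous (fun y => G (expR y) * expR y)}.
  apply: continuousM; last exact: continuous_expR.
  apply: continuous_comp; first exact: continuous_expR.
  by apply: cG; exact: expR_gt0.
pose A (i : nat) : set R := `[expR (- i%:R), expR i%:R]%classic.
pose B (i : nat) : set R := `[- i%:R, i%:R]%classic.
have UA : \bigcup_i A i = Rp.
  apply/seteqP; split => [t [i _]|t] /=.
    rewrite /A/= !in_itv/= andbT => /andP[+ _].
    exact: lt_le_trans (expR_gt0 _).
  rewrite in_itv/= andbT => t0.
  have [y <-] := expR_total t0.
  exists (Num.bound `|y|) => //; rewrite /A/= in_itv/= !ler_expR -ler_norml.
  by apply: ltW; apply: archi_boundP.
have UB : \bigcup_i B i = setT.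
  apply/seteqP; split => // y _; exists (Num.bound `|y|) => //.
  by rewrite /B/= in_itv/= -ler_norml; apply: ltW; apply: archi_boundP.
have ndA : nondecreasing_seq A.
  move=> i j ij; apply/subsetPset => t; rewrite /A/= !in_itv/= => /andP[l u].
  have : (i%:R <= j%:R :> R) by rewrite ler_nat.
  move=> ijR; apply/andP; split.
    by apply: le_trans l; rewrite ler_expR lerN2.
  by apply: (le_trans u); rewrite ler_expR.
have ndB : nondecreasing_seq B.
  move=> i j ij; apply/subsetPset => t; rewrite /B/= !in_itv/= => /andP[l u].
  have : (i%:R <= j%:R :> R) by rewrite ler_nat.
  move=> ijR; apply/andP; split.
    by apply: le_trans l; rewrite lerN2.
  by apply: (le_trans u).
have SA i : A i `<=` Rp by rewrite -UA; exact: bigcup_sup.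
have cvA : (\int[mu]_(x in A i) (G x)%:E @[i --> \oo] --> \int[mu]_(x in Rp) (G x)%:E)%E.
  rewrite -UA; apply: ge0_nondecreasing_set_cvg_integral => // [i|i|i x Aix].
  - exact: measurable_itv.
  - apply/measurable_EFinP; apply: measurable_funS mG => //; exact: SA.
  - rewrite lee_fin; apply: G0; have := SA _ _ Aix.
    by rewrite /= in_itv/= andbT.
have cvB : (\int[mu]_(x in B i) (G (expR x) * expR x)%:E @[i --> \oo] -->
    \int[mu]_x (G (expR x) * expR x)%:E)%E.
  rewrite -UB; apply: ge0_nondecreasing_set_cvg_integral => // [i|i|i x Aix].
  - exact: measurable_itv.
  - apply/measurable_EFinP; apply: measurable_funTS.
    by apply: continuous_measurable_fun => y; exact: cH.
  - by rewrite lee_fin mulr_ge0// ?expR_ge0// G0// expR_gt0.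
have AB i : (\int[mu]_(x in A i) (G x)%:E = \int[mu]_(x in B i) (G (expR x) * expR x)%:E)%E.
  rewrite /A /B integration_by_substitution_increasing ?derive1_expR//.
  - by rewrite lerNl (le_trans _ (ler0n _ i))// oppr_le0.
  - by move=> x y _ _; rewrite ltr_expR.
  - by move=> x _; exact: continuous_expR.
  - apply/cvg_ex; eexists; apply: cvg_at_right_filter; exact: continuous_expR.
  - apply/cvg_ex; eexists; apply: cvg_at_left_filter; exact: continuous_expR.
  - split=> [x _||].
    + exact: derivable_expR.
    + apply: cvg_at_right_filter; exact: continuous_expR.
    + apply: cvg_at_left_filter; exact: continuous_expR.
  - apply: pos_within_continuous => //; exact: expR_gt0.
have EAB : (fun i => \int[mu]_(x in A i) (G x)%:E)%E = (fun i => \int[mu]_(x in B i) (G (expR x) * expR x)%:E)%E.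
  by apply/funext => i; exact: AB.
rewrite EAB in cvA.
exact: (cvg_unique _ cvA cvB).
Qed.

Lemma ge0_integral_fold (f : R -> \bar R) :
  measurable_fun [set: R] f -> (forall t, 0 <= f t)%E ->
  (\int[mu]_t f t = \int[mu]_(t in Rp) (f t + f (- t)%R))%E.
Proof.
move=> mf f0.
have mfN : measurable_fun [set: R] (fun t => f (- t)%R).
  by apply: (measurableT_comp mf); exact: measurable_funN.
rewrite ge0_integralD//; try (by apply: measurable_funTS).
have -> : [set: R] = `]-oo, 0%R]%classic `|` Rp.
  apply/seteqP; split => // x _ /=; rewrite !in_itv/= andbT.
  by case: (leP x 0) => h; [left|right].
rewrite ge0_integral_setU//=; last 2 first.
- by apply: measurable_funTS.
- rewrite disj_set2E; apply/eqP; rewrite -subset0 => x [] /=.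
  by rewrite !in_itv/= andbT leNgt => /negP.
rewrite addeC; congr (_ + _)%E.
transitivity (\int[mu]_(r in `]-oo, 0%R]) (fun t => f (- t)%R) (- r)%R)%E.
  by apply: eq_integral => x _; rewrite opprK.
rewrite -(@ge0_integration_by_substitution0 R (fun t => f (- t)%R))//.
by rewrite -integral_itv_obnd_cbnd//; exact: measurable_funTS.
Qed.

End expR_substitution.

(** * Taylor bounds for sine and cosine, comparison of hyperbolic functions *)

Section elementary_inequalities.
Context {R : realType}.
Implicit Types (f : R -> R) (x y b u : R).

(** Each inequality below, except [expR_even_le], follows from the preceding one by this integration
    step, via the mean value theorem. *)
Lemma derive_ge0_ge0 f (f' : R -> R) : (forall x, is_derive x (1 : R) f (f' x)) ->
  f 0 = 0 -> (forall x, 0 <= x -> 0 <= f' x) -> forall x, 0 <= x -> 0 <= f x.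
Proof.
move=> df f0 f'0 x; rewrite le_eqVlt => /predU1P[<-|x0]; first by rewrite f0.
have cf : {within `[0, x], continuous f}.
  by apply: continuous_subspaceT => y; apply/differentiable_continuous/derivable1_diffP.
have [c] := @MVT R f f' 0 x x0 (fun y _ => df y) cf.
rewrite in_itv/= => /andP[c0 _]; rewrite f0 !subr0 => ->.
by apply: mulr_ge0; [apply: f'0|]; exact: ltW.
Qed.

Lemma sin_le_id x : 0 <= x -> sin x <= x.
Proof.
move=> x0; rewrite -subr_ge0.
apply: (@derive_ge0_ge0 (fun x => x - sin x) (fun x => 1 - cos x)) x0 => //.
by rewrite sin0 subr0.
Qed.

Lemma cos_ge_1B x : 1 - x ^+ 2 / 2 <= cos x.
Proof.
wlog x0 : x / 0 <= x => [W|].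
  have [|x0] := leP 0 x; first exact: W.
  by rewrite -sqrrN -cosN; apply: W; rewrite oppr_ge0 ltW.
rewrite -subr_ge0.
apply: (@derive_ge0_ge0 (fun x => cos x - (1 - x ^+ 2 / 2)) (fun x => x - sin x)) x0.
- by move=> y; apply: is_derive_eq; rewrite /GRing.scale/= /GRing.scale/=; field.
- by rewrite cos0; field.
- by move=> y y0; rewrite subr_ge0 sin_le_id.
Qed.

Lemma sin_ge_cubic x : 0 <= x -> x - x ^+ 3 / 6 <= sin x.
Proof.
move=> x0; rewrite -subr_ge0.
apply: (@derive_ge0_ge0 (fun x => sin x - (x - x ^+ 3 / 6))
  (fun x => cos x - (1 - x ^+ 2 / 2))) x0.
- by move=> y; apply: is_derive_eq; rewrite /GRing.scale/= /GRing.scale/=; field.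
- by rewrite sin0; field.
- by move=> y y0; rewrite subr_ge0 cos_ge_1B.
Qed.

(** This is [cosh (b y) <= cosh y]. With [A = e^(b y)] and [B = e^((1 - b) y)], both at least 1, the
    difference of the two sides factors as [(B - 1) (A^2 B - 1) / (A B)]. *)
Lemma expR_even_le b y : 0 <= b <= 1 -> 0 <= y ->
  expR (b * y) + expR (- (b * y)) <= expR y + expR (- y).
Proof.
move=> /andP[b0 b1] y0.
have A1 : 1 <= expR (b * y) by rewrite -[leLHS]expR0 ler_expR mulr_ge0.
have B1 : 1 <= expR ((1 - b) * y) by rewrite -[leLHS]expR0 ler_expR mulr_ge0// subr_ge0.
have -> : expR y = expR (b * y) * expR ((1 - b) * y).
  by rewrite -expRD -mulrDl addrC subrK mul1r.
have -> : expR (- y) = (expR (b * y) * expR ((1 - b) * y))^-1.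
  by rewrite -expRD -expRN -mulrDl addrC subrK mul1r.
rewrite expRN; set A := expR (b * y) in A1 *; set B := expR _ in B1 *.
have A0 : 0 < A by exact: lt_le_trans A1.
have B0 : 0 < B by exact: lt_le_trans B1.
rewrite -subr_ge0 (_ : _ - _ = (B - 1) * (A ^+ 2 * B - 1) / (A * B)); last first.
  by field; rewrite !gt_eqF.
rewrite divr_ge0 ?mulr_ge0 ?subr_ge0//; try exact: ltW.
rewrite -(mulr1 1) ler_pM// -(mulr1 1); nra.
Qed.

(** This is [sinh (b y) <= b sinh y], whose derivative in [y] is [expR_even_le] multiplied by
    [b]. *)
Lemma expR_odd_le b y : 0 <= b <= 1 -> 0 <= y ->
  expR (b * y) - expR (- (b * y)) <= b * (expR y - expR (- y)).
Proof.
move=> b01 y0; rewrite -subr_ge0.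
apply: (@derive_ge0_ge0 (fun y => b * (expR y - expR (- y)) - (expR (b * y) - expR (- (b * y))))
  (fun y => b * (expR y + expR (- y) - (expR (b * y) + expR (- (b * y)))))) y0.
- by move=> z; apply: is_derive_eq; rewrite /GRing.scale/= /GRing.scale/=; ring.
- by rewrite mulr0 oppr0 expR0; ring.
- move=> z z0; apply: mulr_ge0; first by case/andP: b01.
  by rewrite subr_ge0 expR_even_le.
Qed.

End elementary_inequalities.

(** * Uniqueness for the homogeneous duplication equation *)

Section herglotz.
Context {R : realType}.
Variables (d : R -> R) (K : R).
Hypothesis dK : forall x : R, 0 < x <= 1 -> `|d x| <= K * x.
Hypothesis dE : forall x : R, 0 < x <= 1 -> d (x / 2) = 2 * d x + d (1 - x / 2).

(* A value close to the supremum forces values almost as close at x/2, x/4, ...,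
   which tend to 0. *)
Lemma herglotz (x : R) : 0 < x <= 1 -> d x = 0.
Proof.
have K0 : 0 <= K by have := dK 1; rewrite ltr01 lexx mulr1 => /(_ erefl); exact: le_trans.
pose E := [set `|d x| | x in [set x : R | 0 < x <= 1]] : set R.
have hE : has_sup E.
  split; first by exists `|d 1|; exists 1 => //=; rewrite ltr01 lexx.
  exists K => _ [y /= y1 <-]; apply: (le_trans (dK y y1)).
  by case/andP: y1 => _ y1; rewrite ler_piMr.
set s := sup E.
have ds (y : R) : 0 < y <= 1 -> `|d y| <= s.
  by move=> y1; apply: ub_le_sup; [exact: hE.2|exists y].
have half (y : R) : 0 < y <= 1 -> 0 < y / 2 <= 1.
  by move=> /andP[? ?]; apply/andP; split; lra.
(* Each halving doubles the value and loses at most [s] through the reflected argument [1 - y / 2];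
   the losses add up to [2^k - 1] copies of [s]. *)
have step k (y : R) : 0 < y <= 1 ->
    2 ^+ k * `|d y| - (2 ^+ k - 1) * s <= `|d (y / 2 ^+ k)|.
  elim: k y => [|k IH] y y1; first by rewrite expr0 divr1 subrr mul0r subr0 mul1r.
  have h1 := half _ y1.
  apply: le_trans (_ : 2 ^+ k * `|d (y / 2)| - (2 ^+ k - 1) * s <= _).
    have h2 : 0 < 1 - y / 2 <= 1 by case/andP: h1 => ? ?; case/andP: y1 => ? ?; apply/andP; split; lra.
    have := ds _ h2; have : 2 * `|d y| <= `|d (y / 2)| + `|d (1 - y / 2)|.
      have -> : 2 * `|d y| = `|2 * d y| by rewrite normrM ger0_norm.
      have -> : 2 * d y = d (y / 2) - d (1 - y / 2) by rewrite dE//; ring.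
      exact: ler_normB.
    move=> H1 H2.
    have H3 : 2 * `|d y| - s <= `|d (y / 2)| by lra.
    have P : 0 < 2 ^+ k :> R by rewrite exprn_gt0.
    have := ler_wpM2l (ltW P) H3; rewrite exprS; nra.
  have := IH _ h1.
  by rewrite exprS invfM mulrA.
have s0 : s <= 0.
  rewrite leNgt; apply/negP => s0.
  (* For this [k] the linear bound gives [|d (y / 2^k)| < s / 2] for all [y], while a [y] whose
     value is within [(s / 2) / 2^k] of the supremum forces it above [s / 2]. *)
  have [k kP] : exists k : nat, 2 * K / s < 2 ^+ k.
    exists (Num.bound (2 * K / s)).
    apply: lt_le_trans (archi_boundP _) _.
      by rewrite divr_ge0 ?mulr_ge0// ltW.
    by rewrite -natrX ler_nat ltnW// ltn_expl.
  have P : 0 < 2 ^+ k :> R by rewrite exprn_gt0.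
  have e0 : 0 < s / 2 / 2 ^+ k by rewrite !divr_gt0.
  have [_ [y /= y1 <-]] := sup_adherent e0 hE.
  rewrite -/s => sy.
  have y2 : 0 < y / 2 ^+ k <= 1.
    case/andP: y1 => y1 y1'; rewrite divr_gt0//= ler_pdivrMr// mul1r.
    by rewrite (le_trans y1')// exprn_ege1// ler1n.
  have := step k y y1; have := dK _ y2.
  have H1 : K * (y / 2 ^+ k) < s / 2.
    have : K * (y / 2 ^+ k) <= K / 2 ^+ k.
      rewrite mulrA ler_pM2r ?invr_gt0//; case/andP: y1 => _ y1'; exact: ler_piMr.
    move=> /le_lt_trans; apply.
    rewrite ltr_pdivrMr//; move: kP; rewrite ltr_pdivrMr//; lra.
  have H2 : s / 2 < 2 ^+ k * `|d y| - (2 ^+ k - 1) * s.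
    have : 2 ^+ k * (s - s / 2 / 2 ^+ k) < 2 ^+ k * `|d y| by rewrite ltr_pM2l.
    rewrite mulrBr (mulrC _ (s / 2 / _)) divfK ?gt_eqF//; lra.
  lra.
move=> x1; apply/eqP; rewrite -normr_le0; exact: le_trans (ds x x1) s0.
Qed.

End herglotz.

(** * Improper integrals by antiderivatives, with exponential decay at infinity *)

Section improper_integrals.
Context {R : realType}.
Local Notation mu := (@lebesgue_measure R).
Local Notation Rp := (`]0%R, +oo[%classic : set R).

Lemma ge0_FTC2y (f F : R -> R) (l : R) :
  (forall x : R, is_derive x (1 : R) F (f x)) -> continuous f ->
  (forall x : R, 0 <= x -> 0 <= f x) -> F x @[x --> +oo] --> l ->
  (\int[mu]_(x in Rp) (f x)%:E = (l - F 0)%:E)%E.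
Proof.
move=> dF cf f0 Fl.
rewrite integral_itv_obnd_cbnd; last first.
  by apply/measurable_EFinP; apply: measurable_funTS; exact: continuous_measurable_fun.
rewrite (@ge0_continuous_FTC2y R f F 0 l)//.
- exact: continuous_subspaceT.
- apply: cvg_at_right_filter.
  exact/differentiable_continuous/derivable1_diffP.
- by move=> x _; rewrite derive1E derive_val.
Qed.

Lemma invr_cvgy : (x : R)^-1 @[x --> +oo] --> (0 : R).
Proof.
by apply/(@gtr0_cvgV0 _ _ _ _ id); [exact: nbhs_pinfty_gt|exact: cvg_id].
Qed.

(** Cubing [1 + u <= e^u] at [u = t x / 3] bounds [(1 + x)^3] by a multiple of [e^(t x)], so the
    product is [O(1 / x)]. *)
Lemma cvgy_quadratic_expRN (t C : R) (p : R -> R) : 0 < t ->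
  (forall x : R, 0 <= x -> `|p x| <= C * (1 + x) ^+ 2) ->
  p x * expR (- (t * x)) @[x --> +oo] --> (0 : R).
Proof.
move=> t0 pC.
(* Chosen so that [1 + x <= M (1 + t x / 3)] for all [x >= 0]. *)
pose M := 1 + 3 / t.
have M0 : 0 < M by rewrite addr_gt0// divr_gt0.
have C0 : 0 <= C.
  by have := pC 0 (lexx _); rewrite addr0 expr1n mulr1; exact: le_trans.
have bound (x : R) : 0 < x -> `|p x * expR (- (t * x))| <= C * M ^+ 3 * x^-1.
  move=> x0; have x0' := ltW x0.
  have e1 : 1 + x <= M * expR (t * x / 3).
    apply: (@le_trans _ _ (M * (1 + t * x / 3))).
      rewrite /M (_ : (1 + 3 / t) * (1 + t * x / 3) = 1 + x + t * x / 3 + 3 / t); last first.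
        by field; rewrite gt_eqF.
      have h1 : 0 <= t * x / 3 by rewrite divr_ge0// mulr_ge0// ltW.
      have h2 : 0 <= 3 / t by rewrite divr_ge0// ltW.
      by rewrite -addrA lerDl addr_ge0.
    by rewrite ler_pM2l// expR_ge1Dx.
  have e3 : (1 + x) ^+ 3 <= M ^+ 3 * expR (t * x).
    have -> : expR (t * x) = expR (t * x / 3) ^+ 3.
      by rewrite -expRM_natr divfK.
    by rewrite -exprMn lerXn2r// nnegrE ?addr_ge0// mulr_ge0 ?expR_ge0// ltW.
  rewrite normrM (ger0_norm (expR_ge0 _)) expRN.
  rewrite ler_pdivrMr ?expR_gt0// (le_trans (pC x x0'))//.
  have -> : C * M ^+ 3 * x^-1 * expR (t * x) = C * (x^-1 * (M ^+ 3 * expR (t * x))).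
    ring.
  rewrite ler_wpM2l// ler_pdivlMl//.
  apply: le_trans e3; rewrite exprS ler_wpM2r ?sqr_ge0//.
  by rewrite lerDr.
apply/cvgr0Pnorm_le => e e0.
have Ne : \forall x \near +oo, C * M ^+ 3 * (x : R)^-1 <= e.
  have : C * M ^+ 3 * (x : R)^-1 @[x --> +oo] --> C * M ^+ 3 * 0.
    by apply: cvgM; [exact: cvg_cst|exact: invr_cvgy].
  rewrite mulr0 => /cvgr0Pnorm_le/(_ e e0).
  by apply: filterS => x; apply: le_trans; exact: ler_norm.
near=> x.
apply: (le_trans (bound x _)).
  by near: x; exact: nbhs_pinfty_gt.
by near: x.
Unshelve. all: by end_near. Qed.

Lemma integral_expRN (c : R) : 0 < c ->
  (\int[mu]_(y in Rp) (expR (- (c * y)))%:E = (c^-1)%:E)%E.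
Proof.
move=> c0.
have -> : c^-1 = 0 - - c^-1 * expR (- (c * 0)).
  by rewrite mulr0 oppr0 expR0; ring.
apply: (@ge0_FTC2y _ (fun y => - c^-1 * expR (- (c * y))) 0).
- move=> x; apply: is_derive_eq; rewrite /GRing.scale/= /GRing.scale/=.
  by field; rewrite gt_eqF.
- move=> x; apply: continuous_comp; last exact: continuous_expR.
  by apply: continuousN; apply: continuousM => //; exact: cst_continuous.
- by move=> x _; exact: expR_ge0.
- apply: (@cvgy_quadratic_expRN c `|c^-1|) => // x x0.
  rewrite normrN ler_peMr// exprn_ege1//.
  by rewrite lerDl.
Qed.

End improper_integrals.

(** * The cotangent without its pole at 0 *)

Section cotangent.
Context {R : realType}.
Implicit Types b x : R.

(** The closed form to be identified with the integral [cotint] below. Removing the pole of the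
    cotangent is what makes an [O(b)] bound possible. *)
Definition cotrem b : R := b^-1 - pi / 2 * (cos (pi / 2 * b) / sin (pi / 2 * b)).

Lemma sin_pihalfM_gt0 b : 0 < b <= 1 -> 0 < sin (pi / 2 * b).
Proof.
move=> /andP[b0 b1]; have p0 := @pi_gt0 R; apply: sin_gt0_pi.
by rewrite mulr_gt0 ?divr_gt0//=; nra.
Qed.

(** With [u = pi b / 2 <= 2] the function is [pi / 2] times [(sin u - u cos u) / (u sin u)]. The
    Taylor bounds give at most [u^3 / 2] for the absolute value of the numerator, and
    [sin u >= u / 3], whence the factor [3 / 2]. *)
Lemma cotrem_bound b : 0 < b <= 1 -> `|cotrem b| <= 3 / 2 * (pi / 2) ^+ 2 * b.
Proof.
move=> b01; have s0 := sin_pihalfM_gt0 _ b01; case/andP: (b01) => b0 b1.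
have p0 : 0 < (pi : R) / 2 by rewrite divr_gt0// pi_gt0.
have p2 : (pi : R) / 2 <= 2 by rewrite ltW// pihalf_lt2.
rewrite /cotrem; move: (pi / 2) p0 p2 s0 => P p0 p2; set u := P * b => s0.
have u0 : 0 < u by rewrite mulr_gt0.
have u2 : u <= 2 by rewrite (le_trans (ler_piMr (ltW p0) b1)).
have -> : b^-1 = P / u.
  by rewrite /u; field; rewrite !gt_eqF.
have -> : P / u - P * (cos u / sin u) = P * ((sin u - u * cos u) / (u * sin u)).
  by field; rewrite !gt_eqF.
have -> : 3 / 2 * P ^+ 2 * b = P * (3 / 2 * u) by rewrite /u; ring.
rewrite normrM (gtr0_norm p0) ler_pM2l//.
have us : 0 < u * sin u by rewrite mulr_gt0.
rewrite normrM [X in _ * X]gtr0_norm ?invr_gt0// ler_pdivrMr//.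
have h1 := sin_le_id _ (ltW u0); have h2 := cos_ge_1B u.
have h3 := sin_ge_cubic _ (ltW u0); have h4 := cos_le1 u.
have h5 : u / 3 <= sin u.
  apply: le_trans h3.
  have : u ^+ 2 <= 4 by nra.
  rewrite exprS; nra.
apply: (@le_trans _ _ (3 / 2 * u * (u * (u / 3)))); last first.
  by rewrite !ler_pM2l// ?mulr_gt0.
have -> : 3 / 2 * u * (u * (u / 3)) = u ^+ 3 / 2 by field.
have h6 : u * (1 - u ^+ 2 / 2) <= u * cos u by rewrite ler_pM2l.
have h7 : u * cos u <= u by rewrite ler_piMr// ltW.
have h8 : u * (1 - u ^+ 2 / 2) = u - u ^+ 3 / 2 by field.
have h9 : 0 < u ^+ 3 by rewrite exprn_gt0.
rewrite ler_norml; apply/andP; split; lra.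
Qed.

(** The identity [2 cot (2 v) = cot v - tan v] at [v = pi x / 4], with [tan v = cot (pi / 2 - v)].
    The term [2 / (2 - x)] balances the pole part [1 / (1 - x / 2)] on the right. *)
Lemma cotrem_duplication x : 0 < x <= 1 ->
  cotrem (x / 2) + 2 / (2 - x) = 2 * cotrem x + cotrem (1 - x / 2).
Proof.
move=> x01; case/andP: (x01) => x0 x1.
have s0 : 0 < sin (pi / 2 * (x / 2)) by apply: sin_pihalfM_gt0; apply/andP; split; lra.
have p0 : 0 < (pi : R) / 2 by rewrite divr_gt0// pi_gt0.
have c0 : 0 < cos (pi / 2 * (x / 2)).
  by apply: cos_gt0_pihalf; apply/andP; split; nra.
rewrite /cotrem.
have -> : pi / 2 * (1 - x / 2) = - (pi / 2 * (x / 2) - pi / 2) by rewrite mulrBr mulr1 opprB.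
rewrite cosN sinN cosBpihalf sinBpihalf opprK.
have -> : pi / 2 * x = (pi / 2 * (x / 2)) *+ 2 by rewrite -mulrnAr -(mulr_natr (x / 2)) divfK.
rewrite sin_mulr2n -!(mulr_natl (cos _ * _)) (mulr2n (pi / 2 * _)) cosD.
move: (sin _) (cos _) s0 c0 => s c s0 c0; move: (pi / 2) p0 => P p0.
by field; rewrite !gt_eqF//= ?andbT; lra.
Qed.

(** Here [cot v + tan v = 2 / sin (2 v)] at [v = pi b / 2]. *)
Lemma cotrem_sum b : 0 < b < 1 ->
  b^-1 + (1 - b)^-1 - cotrem b - cotrem (1 - b) = pi / sin (pi * b).
Proof.
move=> /andP[b0 b1].
have p0 : 0 < (pi : R) / 2 by rewrite divr_gt0// pi_gt0.
have s0 : 0 < sin (pi / 2 * b) by apply: sin_pihalfM_gt0; apply/andP; split; lra.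
have c0 : 0 < cos (pi / 2 * b).
  by apply: cos_gt0_pihalf; apply/andP; split; nra.
rewrite /cotrem.
have -> : pi / 2 * (1 - b) = - (pi / 2 * b - pi / 2) by rewrite mulrBr mulr1 opprB.
rewrite cosN sinN cosBpihalf sinBpihalf opprK.
have -> : pi * b = (pi / 2 * b) *+ 2 by rewrite -mulrnAl -(mulr_natr (pi / 2)) divfK.
rewrite sin_mulr2n (mulr2n (cos _ * _)).
have := cos2Dsin2 (pi / 2 * b).
have -> : pi / (cos (pi / 2 * b) * sin (pi / 2 * b) + cos (pi / 2 * b) * sin (pi / 2 * b)) =
   2 * (pi / 2) / (cos (pi / 2 * b) * sin (pi / 2 * b) + cos (pi / 2 * b) * sin (pi / 2 * b)).
  by rewrite (mulrC 2) divfK.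
move: (sin _) (cos _) s0 c0 => s c s0 c0 cs; move: (pi / 2) p0 => P p0.
have -> : b^-1 + (1 - b)^-1 - (b^-1 - P * (c / s)) - ((1 - b)^-1 - P * (s / c))
   = P * ((c ^+ 2 + s ^+ 2) / (c * s)).
  by field; rewrite !gt_eqF//; lra.
have -> : c * s + c * s = 2 * (c * s) by ring.
by rewrite cs; field; rewrite !gt_eqF.
Qed.

End cotangent.

(** * An integral representation of the cotangent *)

Section cotangent_integral.
Context {R : realType}.
Local Notation mu := (@lebesgue_measure R).
Local Notation Rp := (`]0%R, +oo[%classic : set R).
Implicit Types b x y : R.

(** Expanding the denominator into a geometric series shows the partial fractions
    [sum 2 b / (4 n^2 - b^2)] of the cotangent behind the integral of this kernel. In integral form
    the duplication formula becomes a pointwise identity. *)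
Definition cotker b y : R := (expR (b * y) - expR (- (b * y))) / (expR (2 * y) - 1).

Definition cotint b : \bar R := (\int[mu]_(y in Rp) (cotker b y)%:E)%E.

Lemma expR2_gt1 y : 0 < y -> 0 < expR (2 * y) - 1.
Proof. by move=> y0; rewrite subr_gt0 expR_gt1 mulr_gt0. Qed.

Lemma cotker_ge0 b y : 0 <= b -> 0 < y -> 0 <= cotker b y.
Proof.
move=> b0 y0; apply: divr_ge0; last by apply: ltW; exact: expR2_gt1.
rewrite subr_ge0 ler_expR; have : 0 <= b * y by rewrite mulr_ge0// ltW.
lra.
Qed.

Lemma measurable_cotker b (D : set R) : measurable_fun D (cotker b).
Proof. by rewrite /cotker; meas. Qed.

Lemma measurable_cotker2 b (D : set R) : measurable_fun D (fun y => 2 * cotker b (2 * y)).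
Proof. by rewrite /cotker; meas. Qed.

Lemma cotint_ge0 b : 0 <= b -> (0 <= cotint b)%E.
Proof.
move=> b0; apply: integral_ge0 => y /=; rewrite in_itv/= andbT => y0.
by rewrite lee_fin cotker_ge0.
Qed.

(** By [sinh (b y) <= b sinh y] the kernel is at most [b e^(-y)], since
    [2 sinh y / (e^(2 y) - 1) = e^(-y)]. *)
Lemma cotint_le b : 0 <= b <= 1 -> (cotint b <= b%:E)%E.
Proof.
move=> b01; have b0 : 0 <= b by case/andP: b01.
have -> : (b%:E = b%:E * \int[mu]_(y in Rp) (expR (- (1 * y)))%:E)%E.
  by rewrite integral_expRN// -EFinM invr1 mulr1.
rewrite ge0_integralZ_pos//; last by meas.
apply: ge0_le_integral => //.
- by move=> y /=; rewrite in_itv/= andbT => y0; rewrite lee_fin cotker_ge0.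
- by rewrite /cotker; meas.
- by meas.
move=> y /=; rewrite in_itv/= andbT => y0.
rewrite lee_fin /cotker mul1r ler_pdivrMr ?expR2_gt1//.
apply: (le_trans (expR_odd_le _ _ b01 (ltW y0))).
have -> : 2 * y = y + y by ring.
rewrite -mulrA ler_wpM2l// expRD expRN.
have e0 := expR_gt0 y.
rewrite (_ : (_ - _ : R) = (expR y)^-1 * (expR y * expR y - 1))//.
by field; rewrite gt_eqF.
Qed.

Lemma cotint_fin b : 0 <= b <= 1 -> cotint b \is a fin_num.
Proof.
move=> b01; rewrite ge0_fin_numE ?cotint_ge0//; last by case/andP: b01.
by rewrite (le_lt_trans (cotint_le _ b01))// ltry.
Qed.

Lemma cotint_scale b : 0 <= b ->
  cotint b = (\int[mu]_(y in Rp) (2 * cotker b (2 * y))%:E)%E.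
Proof.
move=> b0.
rewrite -(@ge0_integralZ_pos R 2 (fun y => cotker b (2 * y)))//; last 2 first.
- by rewrite /cotker; meas.
- by move=> y y0; rewrite cotker_ge0// mulr_gt0.
rewrite (@ge0_integral_scale R 2 (EFin \o cotker b))//; last 2 first.
- by rewrite /cotker; meas.
- by move=> t t0; rewrite lee_fin cotker_ge0.
by rewrite muleA -EFinM divff// mul1e.
Qed.

Lemma integral_expRN2 (c : R) : 0 < c ->
  ((2 / c)%:E = \int[mu]_(y in Rp) (2 * expR (- (c * y)))%:E)%E.
Proof.
move=> c0; rewrite -ge0_integralZ_pos//; last by meas.
by rewrite integral_expRN// -EFinM.
Qed.

(** After [y -> 2 y] in the terms at [x / 2] and [1 - x / 2], and with [2 / (2 - x)] written as an
    exponential integral, the integrands agree pointwise: both are the same rational function of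
    [e^(x y)] and [e^(2 y)]. *)
Lemma cotint_duplication x : 0 < x <= 1 ->
  (cotint (x / 2) + (2 / (2 - x))%:E = 2%:E * cotint x + cotint (1 - x / 2))%E.
Proof.
move=> /andP[x0 x1].
have h0 : 0 <= x / 2 by lra.
have h1 : 0 <= 1 - x / 2 by lra.
have h2 : 0 < 2 - x by lra.
rewrite (cotint_scale _ h0) (cotint_scale _ h1).
rewrite (integral_expRN2 _ h2) /cotint.
have c0 b y : 0 <= b -> 0 < y -> 0 <= 2 * cotker b (2 * y).
  by move=> b0 y0; rewrite mulr_ge0// cotker_ge0// mulr_gt0.
rewrite ge0_integralZ_pos//; last 2 first.
- exact: measurable_cotker.
- by move=> t t0; rewrite cotker_ge0// ltW.
rewrite !ge0_integralD_pos//; first last.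
- by move=> t t0; exact: c0.
- by meas.
- exact: measurable_cotker2.
- by move=> t t0; exact: c0.
- by move=> t t0; rewrite mulr_ge0 ?cotker_ge0// ltW.
- exact: measurable_cotker2.
- by apply: measurable_funM => //; exact: measurable_cotker.
apply: eq_integral_pos => y y0; rewrite /cotker.
set q := expR (2 * y); set p := expR (x * y).
have p0 : 0 < p by exact: expR_gt0.
have q0 : 0 < q - 1 by exact: expR2_gt1.
have -> : x / 2 * (2 * y) = x * y by field.
have -> : (1 - x / 2) * (2 * y) = 2 * y - x * y by field.
have -> : - ((2 - x) * y) = x * y - 2 * y by ring.
have -> : 2 * (2 * y) = 2 * y + 2 * y by ring.
rewrite opprB !expRB expRN expRD -/p -/q.
by field; rewrite !gt_eqF//=; nra.
Qed.

(** Both sides satisfy the same inhomogeneous duplication formula and an [O(b)] bound, so [herglotz]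
    applies to their difference. *)
Lemma cotint_eq b : 0 < b <= 1 -> cotint b = (cotrem b)%:E.
Proof.
move=> b01.
have fin x : 0 < x <= 1 -> (fine (cotint x))%:E = cotint x.
  by move=> /andP[x0 x1]; rewrite fineK// cotint_fin// ltW.
rewrite -fin//; congr EFin; apply/eqP; rewrite -subr_eq0; apply/eqP.
apply: (@herglotz R (fun b => fine (cotint b) - cotrem b) (1 + 3 / 2 * (pi / 2) ^+ 2)) => // x x01.
- rewrite (le_trans (ler_normB _ _))// mulrDl lerD ?cotrem_bound//.
  rewrite ger0_norm; last by rewrite fine_ge0// cotint_ge0//; case/andP: x01 => /ltW.
  rewrite mul1r -lee_fin fin// cotint_le//.
  by case/andP: x01 => /ltW -> ->.
- have := cotint_duplication _ x01; have := cotrem_duplication _ x01.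
  case/andP: (x01) => x0 x1.
  have h1 : 0 < x / 2 <= 1 by apply/andP; split; lra.
  have h2 : 0 < 1 - x / 2 <= 1 by apply/andP; split; lra.
  rewrite -(fin _ h1) -(fin _ h2) -(fin _ x01).
  rewrite -EFinM -!EFinD => e1 /(congr1 fine) /= e2.
  move: (fine (cotint (x / 2))) (fine (cotint x)) (fine (cotint (1 - x / 2)))
    (cotrem (x / 2)) (cotrem x) (cotrem (1 - x / 2)) (2 / (2 - x)) e1 e2.
  by move=> A B C D E F G e1 e2; lra.
Qed.

End cotangent_integral.


(** * The Mellin transform of [1 / (t^2 + d^2)] *)

Section mellin.
Context {R : realType}.
Local Notation mu := (@lebesgue_measure R).
Local Notation Rp := (`]0%R, +oo[%classic : set R).

(** Folded onto [y > 0], twice the integrand plus the kernels for [b] and [1 - b] is a sum of two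
    pure exponentials, with integral [1 / b + 1 / (1 - b)]; [cotrem_sum] then isolates the sine. *)
Lemma integral_logistic (b : R) : 0 < b < 1 ->
  (\int[mu]_y (expR (2 * b * y) / (1 + expR (2 * y)))%:E =
   (pi / 2 / sin (pi * b))%:E)%E.
Proof.
move=> b01; case/andP: (b01) => b0 b1.
have pos (y : R) : 0 < 1 + expR (2 * y) by rewrite addr_gt0// expR_gt0.
have fpos (y : R) : 0 <= expR (2 * b * y) / (1 + expR (2 * y)).
  by rewrite divr_ge0 ?expR_ge0// ltW.
set M := (\int[mu]_y _)%E.
have M0 : (0 <= M)%E by apply: integral_ge0 => y _; rewrite lee_fin.
(* Written with sums only, so that all integrands are nonnegative and additivity holds before [M] is
   known to be finite. *)
have key : (2%:E * M + cotint b + cotint (1 - b) = (b^-1 + (1 - b)^-1)%:E)%E.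
  have h1 : 0 < 1 - b by lra.
  rewrite (cotint_scale _ (ltW b0)) (cotint_scale _ (ltW h1)).
  have e (c : R) : 0 < c -> c^-1 = 2 / (2 * c).
    by move=> c0; field; rewrite gt_eqF.
  rewrite [RHS]EFinD (e b)// (e (1 - b))// !integral_expRN2 ?mulr_gt0//.
  have -> : (M = \int[mu]_(y in Rp) (expR (2 * b * y) / (1 + expR (2 * y)) +
      expR (2 * b * - y) / (1 + expR (2 * - y)))%:E)%E.
    by rewrite /M ge0_integral_fold//; meas.
  have c0 (c y : R) : 0 < c -> 0 < y -> 0 <= 2 * cotker c (2 * y).
    by move=> c0 y0; rewrite mulr_ge0// cotker_ge0 ?ltW// mulr_gt0.
  rewrite ge0_integralZ_pos//; last by meas.
  rewrite ge0_integralD_pos//; first last.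
  - by move=> t t0; exact: c0.
  - exact: measurable_cotker2.
  - by meas.
  rewrite ge0_integralD_pos//; first last.
  - by move=> t t0; exact: c0.
  - move=> t t0; apply: addr_ge0; last exact: c0.
    by apply: mulr_ge0 => //; exact: addr_ge0.
  - exact: measurable_cotker2.
  - by apply: measurable_funD; [meas|exact: measurable_cotker2].
  rewrite ge0_integralD_pos//; [|by meas..].
  apply: eq_integral_pos => y y0; rewrite /cotker.
  have -> : 2 * b * - y = - (2 * b * y) by ring.
  have -> : 2 * - y = - (2 * y) by ring.
  have -> : 2 * (2 * y) = 2 * y + 2 * y by ring.
  have -> : b * (2 * y) = 2 * b * y by ring.
  have -> : (1 - b) * (2 * y) = 2 * y - 2 * b * y by ring.
  have -> : 2 * (1 - b) * y = 2 * y - 2 * b * y by ring.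
  rewrite opprB !expRB !expRN expRD.
  set q := expR (2 * y); set p := expR (2 * b * y).
  have p0 : 0 < p by exact: expR_gt0.
  have q0 : 0 < q - 1 by exact: expR2_gt1.
  by field; rewrite !gt_eqF//=; nra.
move: key; rewrite !cotint_eq; [|by apply/andP; split; lra..].
move=> key.
have Mfin : M \is a fin_num.
  rewrite ge0_fin_numE// ltey; apply/eqP => My.
  by move: key; rewrite My gt0_muley ?lte_fin//= .
move: key; rewrite -(fineK Mfin) -EFinM -!EFinD => /(congr1 fine) /= key.
congr EFin; have := cotrem_sum _ b01.
have : sin (pi * b) != 0.
  rewrite gt_eqF// sin_gt0_pi// mulr_gt0 ?pi_gt0//=.
  by rewrite gtr_pMr// pi_gt0.
move=> sn0.
have -> : pi / 2 / sin (pi * b) = 2^-1 * (pi / sin (pi * b)) by rewrite mulrA (mulrC 2^-1).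
move=> <-; lra.
Qed.

(** The substitution [t = e^y] turns this into [integral_logistic] at [b = a / 2]. *)
Lemma integral_mellin1 (a : R) : 0 < a < 2 ->
  (\int[mu]_(t in Rp) (t `^ (a - 1) / (t ^+ 2 + 1))%:E = (pi / 2 / sin (pi / 2 * a))%:E)%E.
Proof.
move=> /andP[a0 a2].
rewrite (@ge0_integral_expR_subst R (fun t => t `^ (a - 1) / (t ^+ 2 + 1))).
- have -> : pi / 2 * a = pi * (a / 2) by rewrite -mulrA (mulrC 2^-1).
  rewrite -integral_logistic; last by apply/andP; split; lra.
  apply: eq_integral => y _; congr EFin.
  rewrite -expRM -expRM_natl mulrAC -expRD (addrC (expR _)); congr (expR _ / _).
  by field.
- move=> t t0; apply: continuousM.
    apply/differentiable_continuous/derivable1_diffP; apply: derivable_powR.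
    by rewrite in_itv/= andbT.
  apply: continuousV; first by rewrite gt_eqF// ltr_pwDr// sqr_ge0.
  apply: continuousD; last exact: cst_continuous.
  exact: exprn_continuous.
- by move=> t t0; rewrite divr_ge0 ?powR_ge0// addr_ge0// sqr_ge0.
Qed.

Lemma integral_mellin (a d : R) : 0 < a < 2 -> 0 < d ->
  (\int[mu]_(t in Rp) (t `^ (a - 1) / (t ^+ 2 + d ^+ 2))%:E =
   (d `^ (a - 2) * (pi / 2 / sin (pi / 2 * a)))%:E)%E.
Proof.
move=> a02 d0.
have d2 : 0 < d ^+ 2 by rewrite exprn_gt0.
have fpos (t : R) : 0 <= t `^ (a - 1) / (t ^+ 2 + d ^+ 2).
  by rewrite divr_ge0 ?powR_ge0// addr_ge0// sqr_ge0.
have di : 0 < d^-1 by rewrite invr_gt0.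
have := @ge0_integral_scale R d^-1 (fun t => (d `^ (a - 3) * (t `^ (a - 1) / (t ^+ 2 + 1)))%:E) di.
rewrite invrK => H.
transitivity (\int[mu]_(t in Rp) (d `^ (a - 3) * ((d^-1 * t) `^ (a - 1) / ((d^-1 * t) ^+ 2 + 1)))%:E)%E.
  apply: eq_integral => t; rewrite inE/= in_itv/= andbT => t0; congr EFin.
  rewrite powRM ?(ltW t0) ?(ltW di)//.
  rewrite -(powR_inv1 (ltW d0)) -powRrM mulN1r.
  rewrite mulrA [X in _ = X / _]mulrA -powRD; last by rewrite (gt_eqF d0) implybT.
  have -> : a - 3 - (a - 1) = - 2%:R :> R by ring.
  rewrite powR_invn ?(ltW d0)// powR_inv1 ?(ltW d0)//.
  by field; rewrite !gt_eqF//= ltr_pwDr// sqr_ge0.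
rewrite {}H; last 2 first.
- by meas.
- move=> t t0; rewrite lee_fin mulr_ge0 ?powR_ge0// divr_ge0 ?powR_ge0//.
  by rewrite addr_ge0// sqr_ge0.
rewrite -ge0_integralZ_pos ?powR_ge0//; last 2 first.
- by meas.
- by move=> t _; rewrite divr_ge0 ?powR_ge0// addr_ge0// sqr_ge0.
rewrite integral_mellin1// -!EFinM; congr EFin.
rewrite mulrA; congr (_ * _).
rewrite -{1}(powRr1 (ltW d0)) -powRD; last by rewrite (gt_eqF d0) implybT.
by congr (_ `^ _); ring.
Qed.

End mellin.

(** * Laplace transforms of the regularized cosines *)

Section laplace.
Context {R : realType}.
Local Notation mu := (@lebesgue_measure R).
Local Notation Rp := (`]0%R, +oo[%classic : set R).

(** The growth class of the prefactors [p] in antiderivatives [p x * expR (- (t * x))]; it makes the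
    boundary term at infinity vanish. *)
Definition quad_bounded (p : R -> R) :=
  exists C : R, forall x : R, 0 <= x -> `|p x| <= C * (1 + x) ^+ 2.

Lemma quad_boundedD (p q : R -> R) : quad_bounded p -> quad_bounded q ->
  quad_bounded (fun x => p x + q x).
Proof.
move=> [C pC] [D qD]; exists (C + D) => x x0.
by rewrite (le_trans (ler_normD _ _))// mulrDl lerD ?pC ?qD.
Qed.

Lemma quad_boundedZ (c : R) (p : R -> R) : quad_bounded p ->
  quad_bounded (fun x => c * p x).
Proof.
move=> [C pC]; exists (`|c| * C) => x x0.
by rewrite normrM -mulrA ler_wpM2l ?pC.
Qed.

Lemma quad_bounded1 (p : R -> R) : (forall x : R, `|p x| <= 1) -> quad_bounded p.
Proof.
move=> p1; exists 1 => x x0; rewrite mul1r (le_trans (p1 x))// exprn_ege1//.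
by rewrite lerDl.
Qed.

Lemma quad_bounded_cst (c : R) : quad_bounded (fun=> c).
Proof.
exists `|c| => x x0; rewrite ler_peMr// exprn_ege1// lerDl//.
Qed.

Lemma quad_bounded_id : quad_bounded (fun x => x).
Proof. by exists 1 => x x0; rewrite ger0_norm//; nra. Qed.

Lemma quad_bounded_sqr : quad_bounded (fun x => x ^+ 2).
Proof. by exists 1 => x x0; rewrite ger0_norm ?sqr_ge0//; nra. Qed.

Lemma quad_bounded_expRN (t : R) (p : R -> R) : 0 < t -> quad_bounded p ->
  p x * expR (- (t * x)) @[x --> +oo] --> (0 : R).
Proof. by move=> t0 [C pC]; exact: (@cvgy_quadratic_expRN R t C). Qed.

Lemma laplace_FTC (f p : R -> R) (t : R) : 0 < t -> continuous f ->
  (forall x : R, 0 <= x -> 0 <= f x) ->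
  (forall x : R, is_derive x (1 : R) (fun x => p x * expR (- (t * x))) (f x * expR (- (t * x)))) ->
  quad_bounded p ->
  (\int[mu]_(x in Rp) (f x * expR (- (t * x)))%:E = (- p 0)%:E)%E.
Proof.
move=> t0 cf f0 dp qp.
have -> : - p 0 = 0 - p 0 * expR (- (t * 0)) by rewrite mulr0 oppr0 expR0 mulr1 sub0r.
apply: (@ge0_FTC2y R (fun x : R => f x * expR (- (t * x))) (fun x : R => p x * expR (- (t * x)))) => //.
- move=> x; apply: cvgM; first exact: cf.
  apply: continuous_comp; last exact: continuous_expR.
  by apply: continuousN; apply: continuousM => //; exact: cst_continuous.
- by move=> x x0; rewrite mulr_ge0 ?f0 ?expR_ge0.
- exact: quad_bounded_expRN.
Qed.

Lemma cosd_continuous (d : R) : continuous (fun x : R => cos (d * x)).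
Proof.
move=> x; apply: continuous_comp; last exact: continuous_cos.
by apply: continuousM => //; exact: cst_continuous.
Qed.

Lemma laplace_1Bcos (d t : R) : 0 < t ->
  (\int[mu]_(x in Rp) ((1 - cos (d * x)) * expR (- (t * x)))%:E =
   (d ^+ 2 / (t * (t ^+ 2 + d ^+ 2)))%:E)%E.
Proof.
move=> t0; have h0 : 0 < t ^+ 2 + d ^+ 2 by rewrite ltr_wpDr ?sqr_ge0// exprn_gt0.
pose h := (t ^+ 2 + d ^+ 2)^-1.
(* The bounded solution of [p' - t p = 1 - cos (d x)], as an antiderivative of the form
   [p x * expR (- (t * x))] requires. *)
pose p (x : R) := - t^-1 + (- (h * d)) * sin (d * x) + (h * t) * cos (d * x).
have -> : d ^+ 2 / (t * (t ^+ 2 + d ^+ 2)) = - p 0.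
  by rewrite /p /h mulr0 sin0 cos0; field; rewrite !gt_eqF.
apply: (@laplace_FTC (fun x : R => 1 - cos (d * x)) p) => //.
- by move=> x; apply: continuousB; [exact: cst_continuous|exact: cosd_continuous].
- move=> x; rewrite /p; apply: is_derive_eq; rewrite /GRing.scale/= /GRing.scale/= /h.
  by field; rewrite !gt_eqF.
- rewrite /p; apply: quad_boundedD; first apply: quad_boundedD.
  + exact: quad_bounded_cst.
  + by apply: quad_boundedZ; apply: quad_bounded1 => x; exact: sin_max.
  + by apply: quad_boundedZ; apply: quad_bounded1 => x; exact: cos_max.
Qed.

Lemma cosB1_ge0 (d x : R) : 0 <= cos (d * x) - 1 + d ^+ 2 / 2 * x ^+ 2.
Proof. by have := cos_ge_1B (d * x); rewrite exprMn; lra. Qed.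

Lemma laplace_cosB1 (d t : R) : 0 < t ->
  (\int[mu]_(x in Rp) ((cos (d * x) - 1 + d ^+ 2 / 2 * x ^+ 2) * expR (- (t * x)))%:E =
   (d ^+ 4 / (t ^+ 3 * (t ^+ 2 + d ^+ 2)))%:E)%E.
Proof.
move=> t0; have h0 : 0 < t ^+ 2 + d ^+ 2 by rewrite ltr_wpDr ?sqr_ge0// exprn_gt0.
pose h := (t ^+ 2 + d ^+ 2)^-1.
(* The quadratically bounded solution of [p' - t p = cos (d x) - 1 + d^2 x^2 / 2]. *)
pose p (x : R) := t^-1 - d ^+ 2 / t ^+ 3 + (h * d) * sin (d * x) + (- (h * t)) * cos (d * x)
  + (- (d ^+ 2 / t ^+ 2)) * x + (- (d ^+ 2 / 2 / t)) * x ^+ 2.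
have -> : d ^+ 4 / (t ^+ 3 * (t ^+ 2 + d ^+ 2)) = - p 0.
  by rewrite /p /h mulr0 sin0 cos0; field; rewrite !gt_eqF.
apply: (@laplace_FTC (fun x : R => cos (d * x) - 1 + d ^+ 2 / 2 * x ^+ 2) p) => //.
- move=> x; apply: cvgD.
    by apply: cvgB; [exact: cosd_continuous|exact: cvg_cst].
  by apply: cvgM; [exact: cvg_cst|exact: exprn_continuous].
- by move=> x _; exact: cosB1_ge0.
- move=> x; rewrite /p; apply: is_derive_eq; rewrite /GRing.scale/= /GRing.scale/= /h.
  by field; rewrite !gt_eqF.
- rewrite /p; apply: quad_boundedD; last first.
    by apply: quad_boundedZ; exact: quad_bounded_sqr.
  apply: quad_boundedD; last by apply: quad_boundedZ; exact: quad_bounded_id.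
  apply: quad_boundedD; last first.
    by apply: quad_boundedZ; apply: quad_bounded1 => x; exact: cos_max.
  apply: quad_boundedD; last first.
    by apply: quad_boundedZ; apply: quad_bounded1 => x; exact: sin_max.
  exact: quad_bounded_cst.
Qed.

End laplace.

(** * The Gamma integral and exchange of the order of integration *)

Section gamma_fubini.
Context {R : realType}.
Local Notation mu := (@lebesgue_measure R).
Local Notation Rp := (`]0%R, +oo[%classic : set R).

(** Raise [t <= 8 e^(t / 8)] to the power [g]; the exponent [g t / 8] is at most [t / 2] because
    [g <= 4]. *)
Lemma powR_le_expR (g t : R) : 0 <= g <= 4 -> 0 < t -> t `^ g <= 8 `^ g * expR (t / 2).
Proof.
move=> /andP[g0 g4] t0.
have h : t <= 8 * expR (t / 8).
  by have := expR_ge1Dx (t / 8); lra.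
apply: (@le_trans _ _ ((8 * expR (t / 8)) `^ g)).
  by apply: ge0_ler_powR => //; rewrite nnegrE ?mulr_ge0 ?expR_ge0// ltW.
rewrite powRM ?expR_ge0// ler_wpM2l ?powR_ge0// -expRM ler_expR.
nra.
Qed.

Lemma integral_gamma (g : R) : 0 <= g <= 4 ->
  (\int[mu]_(t in Rp) (t `^ g * expR (- t))%:E = (Defs.Gamma (g + 1))%:E)%E.
Proof.
move=> g04; rewrite /Defs.Gamma /Rintegral addrK fineK// ge0_fin_numE; last first.
  by apply: integral_ge0 => t _; rewrite lee_fin mulr_ge0 ?powR_ge0 ?expR_ge0.
apply: (@le_lt_trans _ _ (\int[mu]_(t in Rp) (8 `^ g * expR (- (2^-1 * t)))%:E)%E).
  apply: ge0_le_integral => //.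
  - by move=> t _; rewrite lee_fin mulr_ge0 ?powR_ge0 ?expR_ge0.
  - by meas.
  - by meas.
  move=> t /=; rewrite in_itv/= andbT => t0; rewrite lee_fin.
  have -> : - (2^-1 * t) = t / 2 + - t by field.
  by rewrite expRD mulrA ler_wpM2r ?expR_ge0// powR_le_expR.
rewrite -ge0_integralZ_pos ?powR_ge0//; last by meas.
by rewrite integral_expRN ?invr_gt0// -EFinM ltry.
Qed.

Lemma Gamma_ge0 (z : R) : 0 <= Defs.Gamma z.
Proof. by apply: Rintegral_ge0 => t _; rewrite mulr_ge0 ?powR_ge0 ?expR_ge0. Qed.

Lemma integral_gamma_scale (g x : R) : 0 <= g <= 4 -> 0 < x ->
  (\int[mu]_(t in Rp) (t `^ g * expR (- (t * x)))%:E =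
   (Defs.Gamma (g + 1) * x `^ (- (g + 1)))%:E)%E.
Proof.
move=> g04 x0.
pose f t := (x `^ (- g) * (t `^ g * expR (- t)))%:E.
transitivity (\int[mu]_(t in Rp) f (x * t)%R)%E.
  apply: eq_integral_pos => t t0; rewrite powRM ?(ltW x0) ?(ltW t0)// (mulrC t).
  rewrite !mulrA -powRD; last by rewrite (gt_eqF x0) implybT.
  by rewrite addNr powRr0 mul1r.
rewrite (@ge0_integral_scale R x f)//; last 2 first.
- by rewrite /f; meas.
- by move=> t t0; rewrite lee_fin !mulr_ge0 ?powR_ge0 ?expR_ge0.
rewrite /f -ge0_integralZ_pos ?powR_ge0//; last 2 first.
- by meas.
- by move=> t t0; rewrite mulr_ge0 ?powR_ge0 ?expR_ge0.
rewrite integral_gamma// -!EFinM mulrA [in RHS]mulrC; congr (_ * _)%:E.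
by rewrite -(powR_inv1 (ltW x0)) -powRD ?opprD 1?addrC// (gt_eqF x0) implybT.
Qed.

Lemma integral_indicE (f : R -> R) :
  (\int[mu]_(t in Rp) (f t)%:E = \int[mu]_t (\1_Rp t * f t)%:E)%E.
Proof.
rewrite integral_mkcond; apply: eq_integral => t _; rewrite patchE indicE.
by case: ifPn => _; rewrite ?mul1r ?mul0r.
Qed.

(** Moving the quadrant into indicators puts the iterated integral on the whole plane, where the
    Tonelli and Fubini theorems are applied. *)
Lemma integral2_indicE (f : R -> R -> R) :
  (\int[mu]_(x in Rp) \int[mu]_(t in Rp) (f x t)%:E =
   \int[mu]_x \int[mu]_t (\1_Rp x * (\1_Rp t * f x t))%:E)%E.
Proof.
rewrite integral_mkcond; apply: eq_integral => x _; rewrite patchE indicE.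
case: ifPn => _.
  by rewrite integral_indicE; apply: eq_integral => t _; rewrite mul1r.
by rewrite integral0_eq// => t _; rewrite mul0r.
Qed.

Lemma integral_gamma_kernel (c g x : R) : 0 <= g <= 4 -> 0 < x ->
  (\int[mu]_(t in Rp) (c * (t `^ g * expR (- (t * x))))%:E =
   (Defs.Gamma (g + 1) * (c * x `^ (- (g + 1))))%:E)%E.
Proof.
move=> g04 x0.
under eq_integral do rewrite EFinM.
rewrite integralZl//; last first.
  apply/integrableP; split; first by meas.
  under eq_integral => t _.
    rewrite gee0_abs; last by rewrite lee_fin mulr_ge0 ?powR_ge0 ?expR_ge0.
    over.
  by rewrite integral_gamma_scale// ltry.
by rewrite integral_gamma_scale// -EFinM mulrCA.
Qed.

Lemma measurable_gamma_kernel (phi : R -> R) (g : R) : measurable_fun [set: R] phi ->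
  measurable_fun [set: R * R] (fun z : R * R =>
    (\1_Rp z.1 * (\1_Rp z.2 * (phi z.1 * (z.2 `^ g * expR (- (z.2 * z.1))))))%:E).
Proof.
move=> mphi.
have mI : measurable_fun [set: R] (\1_Rp : R -> R) by exact: measurable_indic.
apply/measurable_EFinP; apply: measurable_funM.
  exact: measurableT_comp mI measurable_fst.
apply: measurable_funM; first exact: measurableT_comp mI measurable_snd.
apply: measurable_funM; first exact: measurableT_comp mphi measurable_fst.
by meas.
Qed.

(** For nonnegative [phi] the exchange presupposes no convergence, so finiteness of the integral on
    the left can be read off from the one on the right. *)
Lemma tonelli_gamma (phi L : R -> R) (g : R) : 0 <= g <= 4 ->
  measurable_fun [set: R] phi -> (forall x : R, 0 < x -> 0 <= phi x) ->
  (forall t : R, 0 < t ->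
    (\int[mu]_(x in Rp) (phi x * expR (- (t * x)))%:E = (L t)%:E)%E) ->
  ((Defs.Gamma (g + 1))%:E * \int[mu]_(x in Rp) (phi x * x `^ (- (g + 1)))%:E =
   \int[mu]_(t in Rp) (t `^ g * L t)%:E)%E.
Proof.
move=> g04 mphi phi0 lapl.
have mF := @measurable_gamma_kernel phi g mphi.
set F := (X in measurable_fun _ X) in mF.
rewrite ge0_integralZ_pos ?Gamma_ge0//; last 2 first.
- by apply: measurable_funM; [exact: measurable_funTS|meas].
- by move=> t t0; rewrite mulr_ge0 ?phi0 ?powR_ge0.
transitivity (\int[mu]_(x in Rp) \int[mu]_(t in Rp)
    (phi x * (t `^ g * expR (- (t * x))))%:E)%E.
  apply: eq_integral => x; rewrite inE/= in_itv/= andbT => x0.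
  by rewrite integral_gamma_kernel.
rewrite integral2_indicE.
transitivity (\int[mu]_t \int[mu]_x F (x, t))%E.
  apply: (@fubini_tonelli _ _ (measurableTypeR R) (measurableTypeR R) R mu mu F mF).
  move=> [x t]; rewrite /F/= lee_fin indicE; case: (boolP (x \in Rp)); last by rewrite mul0r.
  rewrite inE/= in_itv/= andbT => x0.
  by rewrite !mulr_ge0 ?phi0 ?powR_ge0 ?expR_ge0// indicE.
transitivity (\int[mu]_(t in Rp) \int[mu]_(x in Rp)
    (t `^ g * (phi x * expR (- (t * x))))%:E)%E.
  rewrite integral2_indicE; apply: eq_integral => t _; apply: eq_integral => x _.
  by rewrite /F/=; congr EFin; ring.
apply: eq_integral => t; rewrite inE/= in_itv/= andbT => t0.
rewrite -ge0_integralZ_pos ?powR_ge0//; first by rewrite lapl.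
- by apply: measurable_funM; [exact: measurable_funTS|meas].
- by move=> x x0; rewrite mulr_ge0 ?phi0 ?expR_ge0.
Qed.

(** The counterpart for integrands without a sign. Integrability on the plane is checked with the
    [t] integral inside, where it is an explicit Gamma integral. *)
Lemma fubini_gamma (phi L : R -> R) (g : R) : 0 <= g <= 4 ->
  measurable_fun [set: R] phi ->
  (\int[mu]_(x in Rp) (`|phi x| * x `^ (- (g + 1)))%:E < +oo)%E ->
  (forall t : R, 0 < t ->
    mu.-integrable Rp (fun x => (phi x * expR (- (t * x)))%:E)) ->
  (forall t : R, 0 < t ->
    (\int[mu]_(x in Rp) (phi x * expR (- (t * x)))%:E = (L t)%:E)%E) ->
  (\int[mu]_(x in Rp) (Defs.Gamma (g + 1) * (phi x * x `^ (- (g + 1))))%:E =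
   \int[mu]_(t in Rp) (t `^ g * L t)%:E)%E.
Proof.
move=> g04 mphi phioo iphi lapl.
have mF := @measurable_gamma_kernel phi g mphi.
set F := (X in measurable_fun _ X) in mF.
have iF : (mu \x mu)%E.-integrable setT F.
  apply/integrable12ltyP => //.
  have -> : (\int[mu]_x \int[mu]_y `|F (x, y)| = \int[mu]_(x in Rp)
      \int[mu]_(t in Rp) (`|phi x| * (t `^ g * expR (- (t * x))))%:E)%E.
    rewrite integral2_indicE; apply: eq_integral => x _; apply: eq_integral => t _.
    rewrite /F/= !normrM; congr ((_ * (_ * (_ * _)))%:E).
    + by rewrite ger0_norm// indicE.
    + by rewrite ger0_norm// indicE.
    + by rewrite !ger0_norm ?powR_ge0 ?expR_ge0.
  have -> : (\int[mu]_(x in Rp) \int[mu]_(t in Rp)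
     (`|phi x| * (t `^ g * expR (- (t * x))))%:E =
     \int[mu]_(x in Rp) (Defs.Gamma (g + 1) * (`|phi x| * x `^ (- (g + 1))))%:E)%E.
    apply: eq_integral => x; rewrite inE/= in_itv/= andbT => x0.
    by rewrite integral_gamma_kernel.
  rewrite -ge0_integralZ_pos ?Gamma_ge0//.
  - by rewrite lte_mul_pinfty// ?lee_fin ?Gamma_ge0.
  - apply: measurable_funM; last by meas.
    by apply: measurableT_comp => //; exact: measurable_funTS.
  - by move=> x x0; rewrite mulr_ge0 ?powR_ge0.
transitivity (\int[mu]_(x in Rp) \int[mu]_(t in Rp)
    (phi x * (t `^ g * expR (- (t * x))))%:E)%E.
  apply: eq_integral => x; rewrite inE/= in_itv/= andbT => x0.
  by rewrite integral_gamma_kernel.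
rewrite integral2_indicE.
transitivity (\int[mu]_t \int[mu]_x F (x, t))%E.
  by rewrite (integral21_prod_meas1 iF) -(integral12_prod_meas1 iF).
transitivity (\int[mu]_(t in Rp) \int[mu]_(x in Rp)
    (t `^ g * (phi x * expR (- (t * x))))%:E)%E.
  rewrite integral2_indicE; apply: eq_integral => t _; apply: eq_integral => x _.
  by rewrite /F/=; congr EFin; ring.
apply: eq_integral => t; rewrite inE/= in_itv/= andbT => t0.
under eq_integral do rewrite EFinM.
rewrite integralZl//; last exact: iphi.
by rewrite lapl.
Qed.

End gamma_fubini.

(** * Integrals of regularized cosines against powers, and a logarithmic integral *)

Section power_integrals.
Context {R : realType}.
Local Notation mu := (@lebesgue_measure R).
Local Notation Rp := (`]0%R, +oo[%classic : set R).

Definition mellin_cst (g : R) : R := pi / 2 / sin (pi / 2 * g).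

Lemma mellin_cst_gt0 (g : R) : 0 < g < 2 -> 0 < mellin_cst g.
Proof.
move=> /andP[g0 g2]; have p0 : 0 < (pi : R) / 2 by rewrite divr_gt0// pi_gt0.
rewrite /mellin_cst divr_gt0// sin_gt0_pi// mulr_gt0//=.
by rewrite mulrAC ltr_pdivrMr// ltr_pM2l// pi_gt0.
Qed.

(** Meant for [c = Gamma (g + 1)]: a positive finite product excludes both [c = 0] and [X = +oo],
    which yields the positivity of Gamma and the convergence of the integral together. *)
Lemma mule_eq_pos (c K : R) (X : \bar R) : 0 <= c -> 0 < K -> (0 <= X)%E ->
  (c%:E * X = K%:E)%E -> X = (c^-1 * K)%:E.
Proof.
move=> c0 K0 X0 cX.
have c_gt0 : 0 < c.
  rewrite lt_neqAle c0 andbT; apply/eqP => c0'.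
  by move: cX; rewrite -c0' mul0e => /(congr1 fine)/= K0'; move: K0; rewrite -K0' ltxx.
move: X X0 cX => [r| |]// _.
  by rewrite -EFinM => /(congr1 fine)/= <-; rewrite mulrA mulVf ?mul1r// gt_eqF.
by rewrite gt0_muley.
Qed.

(** After [tonelli_gamma] the powers of [t] combine to the Mellin integrand with exponent [g - 1],
    and [d^2 d^(g - 2) = d^g]. *)
Lemma integral_1Bcos (g d : R) : 0 < g < 2 -> 0 <= d ->
  (\int[mu]_(x in Rp) ((1 - cos (d * x)) * x `^ (- (g + 1)))%:E =
   ((Defs.Gamma (g + 1))^-1 * (mellin_cst g * d `^ g))%:E)%E.
Proof.
move=> g02 d0; case/andP: (g02) => g0 g2.
have g04 : 0 <= g <= 4 by apply/andP; split; lra.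
move: d0; rewrite le_eqVlt => /predU1P[<-|d0].
  rewrite powR0 ?(gt_eqF g0)// !mulr0 integral0_eq// => x _.
  by rewrite mul0r cos0 subrr mul0r.
have ph0 (x : R) : 0 <= 1 - cos (d * x) by rewrite subr_ge0 cos_le1.
apply: mule_eq_pos.
- exact: Gamma_ge0.
- by rewrite mulr_gt0 ?mellin_cst_gt0// powR_gt0.
- by apply: integral_ge0 => x _; rewrite lee_fin mulr_ge0 ?powR_ge0.
rewrite (@tonelli_gamma R (fun x => 1 - cos (d * x))
   (fun t => d ^+ 2 / (t * (t ^+ 2 + d ^+ 2))))//; last 2 first.
- by meas.
- by move=> t t0; exact: laplace_1Bcos.
transitivity (\int[mu]_(t in Rp) (d ^+ 2 * (t `^ (g - 1) / (t ^+ 2 + d ^+ 2)))%:E)%E.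
  apply: eq_integral_pos => t t0.
  rewrite powRB ?(gt_eqF t0) ?implybT// powRr1 ?ltW//.
  by field; rewrite !gt_eqF// ltr_pwDr ?sqr_ge0// exprn_gt0.
rewrite -ge0_integralZ_pos ?sqr_ge0//; last 2 first.
- by meas.
- by move=> t _; rewrite divr_ge0 ?powR_ge0// addr_ge0// sqr_ge0.
rewrite integral_mellin// -EFinM (mulrA (d ^+ 2)) (mulrC (mellin_cst g)); congr (_ * _)%:E.
rewrite powRB ?(gt_eqF d0) ?implybT// powR_mulrn ?(ltW d0)//.
by field; rewrite gt_eqF.
Qed.

(** The extra factor [t^(-2)] in the Laplace transform shifts the Mellin parameter to [g - 2], back
    into the interval from 0 to 2. *)
Lemma integral_cosB1 (g d : R) : 2 < g < 4 -> 0 <= d ->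
  (\int[mu]_(x in Rp) ((cos (d * x) - 1 + d ^+ 2 / 2 * x ^+ 2) * x `^ (- (g + 1)))%:E =
   ((Defs.Gamma (g + 1))^-1 * (mellin_cst (g - 2) * d `^ g))%:E)%E.
Proof.
move=> /andP[g2 g4] d0.
have g04 : 0 <= g <= 4 by apply/andP; split; lra.
have g02 : 0 < g - 2 < 2 by apply/andP; split; lra.
have g0 : 0 < g by lra.
move: d0; rewrite le_eqVlt => /predU1P[<-|d0].
  rewrite powR0 ?(gt_eqF g0)// !mulr0 integral0_eq// => x _.
  by rewrite mul0r cos0 subrr expr0n/= !mul0r add0r mul0r.
apply: mule_eq_pos.
- exact: Gamma_ge0.
- by rewrite mulr_gt0 ?mellin_cst_gt0// powR_gt0.
- by apply: integral_ge0 => x _; rewrite lee_fin mulr_ge0 ?powR_ge0 ?cosB1_ge0.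
rewrite (@tonelli_gamma R (fun x => cos (d * x) - 1 + d ^+ 2 / 2 * x ^+ 2)
   (fun t => d ^+ 4 / (t ^+ 3 * (t ^+ 2 + d ^+ 2))))//; last 3 first.
- by meas.
- by move=> t _; exact: cosB1_ge0.
- by move=> t t0; exact: laplace_cosB1.
transitivity (\int[mu]_(t in Rp) (d ^+ 4 * (t `^ (g - 2 - 1) / (t ^+ 2 + d ^+ 2)))%:E)%E.
  apply: eq_integral_pos => t t0.
  have -> : g - 2 - 1 = g - 3%:R by ring.
  rewrite powRB ?(gt_eqF t0) ?implybT// powR_mulrn ?(ltW t0)//.
  by field; rewrite !gt_eqF// ltr_pwDr ?sqr_ge0// exprn_gt0.
rewrite -ge0_integralZ_pos ?exprn_ge0 ?(ltW d0)//; last 2 first.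
- by meas.
- by move=> t _; rewrite divr_ge0 ?powR_ge0// addr_ge0// sqr_ge0.
rewrite integral_mellin// -EFinM (mulrA (d ^+ 4)) (mulrC (mellin_cst _)); congr (_ * _)%:E.
have -> : g - 2 - 2 = g - 4%:R by ring.
rewrite powRB ?(gt_eqF d0) ?implybT// powR_mulrn ?(ltW d0)//.
by field; rewrite gt_eqF.
Qed.

Lemma Gamma3 : Defs.Gamma (2 + 1) = 2 :> R.
Proof.
apply/eqP; rewrite -eqe -integral_gamma; last by apply/andP; split; lra.
pose p (x : R) := - 2 + (- 2) * x + (- 1) * x ^+ 2.
have p0 : - p 0 = 2 by rewrite /p; ring.
rewrite -[X in _ == X%:E]p0.
apply/eqP; transitivity (\int[mu]_(t in Rp) (t ^+ 2 * expR (- (1 * t)))%:E)%E.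
  by apply: eq_integral_pos => t t0; rewrite powR_mulrn ?(ltW t0)// mul1r.
apply: (@laplace_FTC R (fun x : R => x ^+ 2) p) => //.
- exact: exprn_continuous.
- by move=> x _; exact: sqr_ge0.
- by move=> x; rewrite /p; apply: is_derive_eq; rewrite /GRing.scale/= /GRing.scale/=; ring.
- apply: quad_boundedD; last by apply: quad_boundedZ; exact: quad_bounded_sqr.
  apply: quad_boundedD; last by apply: quad_boundedZ; exact: quad_bounded_id.
  exact: quad_bounded_cst.
Qed.

(** The order of [a] and [b] makes the integrand nonnegative, as [ge0_FTC2y] demands. The
    antiderivative vanishes at infinity by [ln (1 + u) <= u], which bounds it by [(b^2 - a^2) / x]
    for [x >= 1]. *)
Lemma integral_log_ge0 (a b : R) : 0 < a -> a <= b ->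
  (\int[mu]_(t in Rp) (t / (t ^+ 2 + a ^+ 2) - t / (t ^+ 2 + b ^+ 2))%:E =
   (ln b - ln a)%:E)%E.
Proof.
move=> a0 ab; have b0 : 0 < b by exact: lt_le_trans ab.
have pos (c x : R) : 0 < c -> 0 < x ^+ 2 + c ^+ 2.
  by move=> c0; rewrite ltr_pwDr ?exprn_gt0// sqr_ge0.
pose F (x : R) := 2^-1 * (ln (x ^+ 2 + a ^+ 2) - ln (x ^+ 2 + b ^+ 2)).
have -> : ln b - ln a = 0 - F 0.
  by rewrite /F expr0n/= !add0r !lnXn//; field.
apply: (@ge0_FTC2y R (fun t : R => t / (t ^+ 2 + a ^+ 2) - t / (t ^+ 2 + b ^+ 2)) F).
- have dln (c x : R) : 0 < c -> is_derive x (1 : R) (fun x => ln (x ^+ 2 + c ^+ 2))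
      (2 * x / (x ^+ 2 + c ^+ 2)).
    move=> c0; have h := pos c x c0.
    have dl := is_derive1_ln h.
    apply: is_derive_eq.
    by rewrite /GRing.scale/= /GRing.scale/=; ring.
  move=> x; have d1 := dln a x a0; have d2 := dln b x b0.
  apply: is_derive_eq; rewrite /GRing.scale/= /GRing.scale/=.
  by field; rewrite !gt_eqF ?pos.
- have cq (c : R) : 0 < c -> continuous (fun t : R => t / (t ^+ 2 + c ^+ 2)).
    move=> c0 x; apply: cvgM; first exact: cvg_id.
    apply: cvgV; first by rewrite gt_eqF// pos.
    by apply: cvgD; [exact: exprn_continuous|exact: cvg_cst].
  by move=> x; apply: cvgB; exact: cq.
- move=> x x0; rewrite -mulrBr mulr_ge0// subr_ge0 lef_pV2 ?posrE ?pos//.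
  by rewrite lerD2l lerXn2r// nnegrE ltW.
- apply/cvgr0Pnorm_le => e e0.
  have Ne : \forall x \near +oo, (b ^+ 2 - a ^+ 2) * (x : R)^-1 <= e.
    have : (b ^+ 2 - a ^+ 2) * (x : R)^-1 @[x --> +oo] --> (b ^+ 2 - a ^+ 2) * 0.
      by apply: cvgM; [exact: cvg_cst|exact: invr_cvgy].
    rewrite mulr0 => /cvgr0Pnorm_le/(_ e e0).
    by apply: filterS => x; apply: le_trans; exact: ler_norm.
  have ab2 : 0 <= b ^+ 2 - a ^+ 2 by rewrite subr_ge0 lerXn2r// nnegrE ltW.
  near=> x.
  have x1 : 1 <= x by near: x; apply: nbhs_pinfty_ge.
  apply: (@le_trans _ _ ((b ^+ 2 - a ^+ 2) * x^-1)); last by near: x.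
  rewrite /F normrM ger0_norm ?invr_ge0// distrC.
  have pa := pos a x a0; have pb := pos b x b0.
  have hl : ln (x ^+ 2 + b ^+ 2) - ln (x ^+ 2 + a ^+ 2) <= (b ^+ 2 - a ^+ 2) / (x ^+ 2 + a ^+ 2).
    rewrite -ln_div ?posrE//.
    have -> : (x ^+ 2 + b ^+ 2) / (x ^+ 2 + a ^+ 2) = 1 + (b ^+ 2 - a ^+ 2) / (x ^+ 2 + a ^+ 2).
      by field; rewrite gt_eqF.
    by apply: le_ln1Dx; rewrite (lt_le_trans _ (divr_ge0 ab2 (ltW pa)))// ltrN10.
  have hl0 : 0 <= ln (x ^+ 2 + b ^+ 2) - ln (x ^+ 2 + a ^+ 2).
    by rewrite subr_ge0 ler_ln ?posrE// lerD2l -subr_ge0.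
  rewrite ger0_norm//.
  have hx : (b ^+ 2 - a ^+ 2) / (x ^+ 2 + a ^+ 2) <= (b ^+ 2 - a ^+ 2) * x^-1.
    have x0 : 0 < x by exact: lt_le_trans ltr01 x1.
    rewrite ler_wpM2l// lef_pV2 ?posrE//.
    by have := sqr_ge0 a; nra.
  lra.
Unshelve. all: by end_near. Qed.

Lemma integral_log (d : R) : 0 < d ->
  (\int[mu]_(t in Rp) (t / (t ^+ 2 + d ^+ 2) - t / (t ^+ 2 + 1))%:E =
   (- ln d)%:E)%E.
Proof.
move=> d0; have [d1|/ltW d1] := leP d 1.
  by have := integral_log_ge0 _ _ d0 d1; rewrite expr1n ln1 sub0r.
have := integral_log_ge0 _ _ (@ltr01 R) d1; rewrite expr1n ln1 subr0 => H.
rewrite EFinN -H -integral_ge0N.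
  by apply: eq_integral => t _; rewrite -EFinN opprB.
move=> t /=; rewrite in_itv/= andbT => t0.
rewrite lee_fin -mulrBr mulr_ge0 ?(ltW t0)// subr_ge0 lef_pV2 ?posrE; last 2 first.
- by rewrite ltr_pwDr ?exprn_gt0// sqr_ge0.
- by rewrite ltr_pwDr ?sqr_ge0.
by rewrite lerD2l -[leLHS](expr1n _ 2) lerXn2r// nnegrE ltW.
Qed.

End power_integrals.

(** * The borderline exponent [gamma = 2] *)

Section log_case.
Context {R : realType}.
Local Notation mu := (@lebesgue_measure R).
Local Notation Rp := (`]0%R, +oo[%classic : set R).

Lemma ge0_integrable_pos (f : R -> R) (v : R) : measurable_fun Rp f ->
  (forall t : R, 0 < t -> 0 <= f t) -> (\int[mu]_(t in Rp) (f t)%:E = v%:E)%E ->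
  mu.-integrable Rp (fun t => (f t)%:E).
Proof.
move=> mf f0 fv; apply/integrableP; split; first exact/measurable_EFinP.
have -> : (\int[mu]_(t in Rp) `|(f t)%:E| = \int[mu]_(t in Rp) (f t)%:E)%E.
  apply: eq_integral => t; rewrite inE/= in_itv/= andbT => t0.
  by rewrite /= ger0_norm ?f0.
by rewrite fv ltry.
Qed.

Lemma integrable_log (d : R) : 0 < d ->
  mu.-integrable Rp (fun t => (t / (t ^+ 2 + d ^+ 2) - t / (t ^+ 2 + 1))%:E).
Proof.
have ge (a b : R) : 0 < a -> a <= b ->
    mu.-integrable Rp (fun t => (t / (t ^+ 2 + a ^+ 2) - t / (t ^+ 2 + b ^+ 2))%:E).
  move=> a0 ab; apply: ge0_integrable_pos (integral_log_ge0 _ _ a0 ab); first by meas.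
  have b0 : 0 < b by exact: lt_le_trans ab.
  move=> t t0; rewrite -mulrBr mulr_ge0 ?(ltW t0)// subr_ge0 lef_pV2 ?posrE;
    [|by rewrite ltr_pwDr ?exprn_gt0// sqr_ge0..].
  by rewrite lerD2l lerXn2r// nnegrE ltW.
move=> d0; have [d1|/ltW d1] := leP d 1.
  by have := ge _ _ d0 d1; rewrite expr1n.
have /integrableN := ge _ _ ltr01 d1; rewrite expr1n.
by apply: eq_integrable => // t _; rewrite /= opprB.
Qed.

(** Against [x^(-3)], [1 - cos (d x)] diverges logarithmically at 0, and subtracting [d^2 x^2 / 2]
    would diverge at infinity. The bounded term [d^2 (1 - cos x)] has the same quadratic part at 0
    and avoids both. *)
Definition logker (d x : R) : R := (1 - cos (d * x)) - d ^+ 2 * (1 - cos (1 * x)).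

(* Exponents 3/2 and 5/2 dominate the borderline exponent 2 on [1, +oo[ and ]0, 1]. *)
Lemma logker_absolutely_integrable (d : R) : 0 <= d ->
  (\int[mu]_(x in Rp) (`|logker d x| * x `^ (- (2 + 1)))%:E < +oo)%E.
Proof.
move=> d0.
pose A (c x : R) := 1 - cos (c * x).
pose B (c x : R) := cos (c * x) - 1 + c ^+ 2 / 2 * x ^+ 2.
have A0 (c x : R) : 0 <= A c x by rewrite subr_ge0 cos_le1.
have B0 (c x : R) : 0 <= B c x by exact: cosB1_ge0.
pose p (x : R) := x `^ (- (3 / 2 + 1)).
pose q (x : R) := x `^ (- (5 / 2 + 1)).
have p0 (x : R) : 0 <= p x by exact: powR_ge0.
have q0 (x : R) : 0 <= q x by exact: powR_ge0.
have d2 := sqr_ge0 d.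
have mA (c : R) : measurable_fun Rp (fun x => A c x * p x) by rewrite /A /p; meas.
have mB (c : R) : measurable_fun Rp (fun x => B c x * q x) by rewrite /B /q; meas.
have iA (c : R) : 0 <= c -> (\int[mu]_(x in Rp) (A c x * p x)%:E < +oo)%E.
  by move=> c0; rewrite integral_1Bcos ?ltry//; apply/andP; split; lra.
have iB (c : R) : 0 <= c -> (\int[mu]_(x in Rp) (B c x * q x)%:E < +oo)%E.
  by move=> c0; rewrite integral_cosB1 ?ltry//; apply/andP; split; lra.
pose U (x : R) := A d x * p x + d ^+ 2 * (A 1 x * p x).
pose V (x : R) := B d x * q x + d ^+ 2 * (B 1 x * q x).
have mU : measurable_fun Rp U.
  by apply: measurable_funD => //; apply: measurable_funM.
have mV : measurable_fun Rp V.
  by apply: measurable_funD => //; apply: measurable_funM.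
have U0 (x : R) : 0 <= U x by rewrite addr_ge0 ?mulr_ge0.
have V0 (x : R) : 0 <= V x by rewrite addr_ge0 ?mulr_ge0.
apply: (@le_lt_trans _ _ (\int[mu]_(x in Rp) (U x + V x)%:E)%E); last first.
  rewrite -ge0_integralD_pos// lte_add_pinfty//.
    rewrite -ge0_integralD_pos//; [|exact: measurable_funM|by move=> *; rewrite !mulr_ge0..].
    rewrite lte_add_pinfty ?iA// -ge0_integralZ_pos//; last by move=> *; rewrite mulr_ge0.
    by rewrite lte_mul_pinfty// iA.
  rewrite -ge0_integralD_pos//; [|exact: measurable_funM|by move=> *; rewrite !mulr_ge0..].
  rewrite lte_add_pinfty ?iB// -ge0_integralZ_pos//; last by move=> *; rewrite mulr_ge0.
  by rewrite lte_mul_pinfty// iB.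
apply: ge0_le_integral => //.
- by move=> x _; rewrite lee_fin mulr_ge0 ?powR_ge0.
- by rewrite /logker; meas.
- by apply/measurable_EFinP; exact: measurable_funD.
move=> x /=; rewrite in_itv/= andbT => x0; rewrite lee_fin.
have E1 : `|logker d x| <= A d x + d ^+ 2 * A 1 x.
  rewrite /logker (le_trans (ler_normB _ _))// lerD//.
    by rewrite ger0_norm// A0.
  by rewrite ger0_norm// mulr_ge0// A0.
have E2 : `|logker d x| <= B d x + d ^+ 2 * B 1 x.
  (* The quadratic terms of the two [B] cancel, so the bound near 0 is available for the same
     function. *)
  have -> : logker d x = d ^+ 2 * B 1 x - B d x by rewrite /logker /B; field.
  by rewrite [leRHS]addrC (le_trans (ler_normB _ _))// lerD// ger0_norm// mulr_ge0.
have [x1|/ltW x1] := leP x 1.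
  apply: (@le_trans _ _ (V x)); last by rewrite lerDr.
  have -> : V x = (B d x + d ^+ 2 * B 1 x) * q x by rewrite /V; ring.
  apply: ler_pM => //; first exact: powR_ge0.
  by rewrite /q ger_powR ?x0//; lra.
apply: (@le_trans _ _ (U x)); last by rewrite lerDl.
have -> : U x = (A d x + d ^+ 2 * A 1 x) * p x by rewrite /U; ring.
apply: ler_pM => //; first exact: powR_ge0.
by rewrite /p ler_powR//; lra.
Qed.

Lemma integrable_logker (d : R) : 0 <= d ->
  mu.-integrable Rp (fun x => (logker d x * x `^ (- (2 + 1)))%:E).
Proof.
move=> d0; apply/integrableP; split; first by rewrite /logker; meas.
apply: le_lt_trans (logker_absolutely_integrable _ d0).
rewrite le_eqVlt; apply/orP; left; apply/eqP; apply: eq_integral => x _.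
by rewrite abse_EFin normrM (ger0_norm (powR_ge0 _ _)).
Qed.

(** Multiplied by [t^2], the difference of the two Laplace transforms is [d^2] times the integrand
    of [integral_log]; the factor [2^-1] is [1 / Gamma 3]. *)
Lemma integral_logker (d : R) : 0 <= d ->
  (\int[mu]_(x in Rp) (logker d x * x `^ (- (2 + 1)))%:E =
   (- (2^-1 * (if d == 0 then 0 else d ^+ 2 * ln d)))%:E)%E.
Proof.
move=> d0; have [->|dn0] := eqVneq d 0.
  rewrite mulr0 oppr0 integral0_eq// => x _.
  by rewrite /logker mul0r cos0 subrr expr0n/= mul0r subrr mul0r.
have {}d0 : 0 < d by rewrite lt_neqAle eq_sym dn0.
have g04 : 0 <= (2 : R) <= 4 by apply/andP; split; lra.
have iE (c t : R) : 0 < t -> mu.-integrable Rp (fun x => ((1 - cos (c * x)) * expR (- (t * x)))%:E).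
  move=> t0; apply: ge0_integrable_pos (laplace_1Bcos _ _ t0); first by meas.
  by move=> x x0; rewrite mulr_ge0 ?expR_ge0// subr_ge0 cos_le1.
have iD (t : R) : 0 < t ->
    mu.-integrable Rp (fun x => ((d ^+ 2)%:E * ((1 - cos (1 * x)) * expR (- (t * x)))%:E)%E).
  by move=> t0; apply: integrableZl => //; exact: iE.
have eqL (t : R) : (fun x : R => (logker d x * expR (- (t * x)))%:E) =
   ((fun x : R => ((1 - cos (d * x)) * expR (- (t * x)))%:E) \-
   (fun x : R => ((d ^+ 2)%:E * ((1 - cos (1 * x)) * expR (- (t * x)))%:E)))%E.
  apply/funext => x; rewrite /= /logker.
  by have -> : ((1 - cos (d * x)) - d ^+ 2 * (1 - cos (1 * x))) * expR (- (t * x)) =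
    (1 - cos (d * x)) * expR (- (t * x)) - d ^+ 2 * ((1 - cos (1 * x)) * expR (- (t * x)))
    by ring.
have H := @fubini_gamma R (logker d)
  (fun t => d ^+ 2 / (t * (t ^+ 2 + d ^+ 2)) - d ^+ 2 / (t * (t ^+ 2 + 1))) 2 g04.
have {H} : (\int[mu]_(x in Rp) (Defs.Gamma (2 + 1) * (logker d x * x `^ (- (2 + 1))))%:E =
   (d ^+ 2)%:E * \int[mu]_(t in Rp) (t / (t ^+ 2 + d ^+ 2) - t / (t ^+ 2 + 1))%:E)%E.
  rewrite H.
  - rewrite -integralZl//; last exact: integrable_log.
    apply: eq_integral => t; rewrite inE/= in_itv/= andbT => t0.
    rewrite -EFinM powR_mulrn ?(ltW t0)//; congr EFin.
    field; rewrite !gt_eqF// ltr_pwDr ?sqr_ge0// exprn_gt0//.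
  - by rewrite /logker; meas.
  - exact: logker_absolutely_integrable (ltW d0).
  - move=> t t0; rewrite eqL; apply: integrableB => //; [exact: iE|exact: iD].
  - move=> t t0; rewrite eqL integralB//; [|exact: iE|exact: iD].
    rewrite integralZl//; last exact: iE.
    by rewrite !laplace_1Bcos// expr1n mul1r -EFinM -EFinB.
rewrite integral_log// Gamma3.
under eq_integral do rewrite EFinM.
rewrite integralZl//; last exact: integrable_logker (ltW d0).
set X := (\int[mu]_(x in _) _)%E => HX.
have -> : (X = 2^-1%:E * (2%:E * X))%E by rewrite muleA -EFinM mulVf// mul1e.
by rewrite HX -!EFinM; congr EFin; ring.
Qed.

End log_case.

(** * Weighted cosine sums with vanishing moments *)

Section cosine_sums.
Context {R : realType}.
Local Notation mu := (@lebesgue_measure R).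
Local Notation Rp := (`]0%R, +oo[%classic : set R).
Variable I : finType.
Implicit Types (w v e : I -> R).

Lemma integral_lincomb w v (f : I -> R -> R) :
  (forall i, mu.-integrable Rp (fun x => (f i x)%:E)) ->
  (forall i, (\int[mu]_(x in Rp) (f i x)%:E = (v i)%:E)%E) ->
  mu.-integrable Rp (fun x => (\sum_i w i * f i x)%:E) /\
  (\int[mu]_(x in Rp) (\sum_i w i * f i x)%:E = (\sum_i w i * v i)%:E)%E.
Proof.
move=> fi fv.
have E : (fun x : R => (\sum_i w i * f i x)%:E) = (fun x => \sum_i ((w i)%:E * (f i x)%:E))%E.
  by apply/funext => x; rewrite -sumEFin.
have ii i : mu.-integrable Rp (fun x => ((w i)%:E * (f i x)%:E)%E).
  exact: integrableZl.
rewrite E; split; first by apply: integrable_sum => // i _; exact: ii.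
rewrite integral_sum//.
by rewrite -sumEFin; apply: eq_bigr => i _; rewrite integralZl// fv -EFinM.
Qed.

(** A shift of the sine by [pi]. It gives the ranges [g < 2] and [g > 2] one common formula, in the
    manner of an analytic continuation. *)
Lemma mellin_cstB2 (g : R) : mellin_cst (g - 2) = - mellin_cst g.
Proof.
rewrite /mellin_cst mulrBr divfK// sinB cospi sinpi mulr0 subr0 mulrN1.
by rewrite invrN mulrN.
Qed.

(** The single cosines are not integrable against the power; the two moment conditions allow each to
    be replaced by its regularization without changing the sum. *)
Lemma cosine_sum_integral (g : R) w e : 0 < g < 3 -> g != 2 ->
  (forall i, 0 <= e i) -> \sum_i w i = 0 -> \sum_i w i * e i ^+ 2 = 0 ->
  mu.-integrable Rp (fun x => ((\sum_i w i * cos (e i * x)) * x `^ (- (g + 1)))%:E) /\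
  (\int[mu]_(x in Rp) ((\sum_i w i * cos (e i * x)) * x `^ (- (g + 1)))%:E =
   ((Defs.Gamma (g + 1))^-1 * (- mellin_cst g * \sum_i w i * e i `^ g))%:E)%E.
Proof.
move=> /andP[g0 g3] gn2 e0 w0 we0.
have [g2|g2] := ltP g 2.
  have g02 : 0 < g < 2 by rewrite g0.
  pose f i (x : R) := (1 - cos (e i * x)) * x `^ (- (g + 1)).
  have fv i : (\int[mu]_(x in Rp) (f i x)%:E =
      ((Defs.Gamma (g + 1))^-1 * (mellin_cst g * e i `^ g))%:E)%E.
    exact: integral_1Bcos.
  have fi i : mu.-integrable Rp (fun x => (f i x)%:E).
    apply: ge0_integrable_pos (fv i); first by rewrite /f; meas.
    by move=> x x0; rewrite mulr_ge0 ?powR_ge0// subr_ge0 cos_le1.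
  have [H1 H2] := integral_lincomb (fun i => - w i) _ _ fi fv.
  have E : (fun x : R => ((\sum_i w i * cos (e i * x)) * x `^ (- (g + 1)))%:E) =
     (fun x => (\sum_i - w i * f i x)%:E).
    apply/funext => x; congr EFin.
    transitivity ((\sum_i w i * cos (e i * x) - \sum_i w i) * x `^ (- (g + 1))).
      by rewrite w0 subr0.
    rewrite -sumrB mulr_suml.
    by apply: eq_bigr => i _; rewrite /f; ring.
  rewrite E; split => //; rewrite H2; congr EFin.
  rewrite !mulr_sumr; apply: eq_bigr => i _.
  move: (Defs.Gamma _) (mellin_cst g) => G M; ring.
have {}g2 : 2 < g by rewrite lt_neqAle eq_sym gn2.
have g24 : 2 < g < 4 by apply/andP; split; lra.
pose f i (x : R) := (cos (e i * x) - 1 + e i ^+ 2 / 2 * x ^+ 2) * x `^ (- (g + 1)).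
have fv i : (\int[mu]_(x in Rp) (f i x)%:E =
    ((Defs.Gamma (g + 1))^-1 * (mellin_cst (g - 2) * e i `^ g))%:E)%E.
  exact: integral_cosB1.
have fi i : mu.-integrable Rp (fun x => (f i x)%:E).
  apply: ge0_integrable_pos (fv i); first by rewrite /f; meas.
  by move=> x x0; rewrite mulr_ge0 ?powR_ge0// cosB1_ge0.
have [H1 H2] := integral_lincomb w _ _ fi fv.
have E : (fun x : R => ((\sum_i w i * cos (e i * x)) * x `^ (- (g + 1)))%:E) =
   (fun x => (\sum_i w i * f i x)%:E).
  apply/funext => x; congr EFin.
  transitivity ((\sum_i w i * cos (e i * x) - \sum_i w i
      + (\sum_i w i * e i ^+ 2) * (x ^+ 2 / 2)) * x `^ (- (g + 1))).
    by rewrite w0 we0 subr0 mul0r addr0.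
  rewrite -sumrB [X in _ + X]mulr_suml -big_split/= mulr_suml.
  by apply: eq_bigr => i _; rewrite /f; ring.
rewrite E; split => //; rewrite H2; congr EFin.
rewrite !mulr_sumr; apply: eq_bigr => i _; rewrite mellin_cstB2.
move: (Defs.Gamma _) (mellin_cst g) => G M; ring.
Qed.

Lemma cosine_sum_integral_log w e :
  (forall i, 0 <= e i) -> \sum_i w i = 0 -> \sum_i w i * e i ^+ 2 = 0 ->
  mu.-integrable Rp (fun x => ((\sum_i w i * cos (e i * x)) * x `^ (- (2 + 1)))%:E) /\
  (\int[mu]_(x in Rp) ((\sum_i w i * cos (e i * x)) * x `^ (- (2 + 1)))%:E =
   (2^-1 * \sum_i w i * (if e i == 0 then 0 else e i ^+ 2 * ln (e i)))%:E)%E.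
Proof.
move=> e0 w0 we0.
pose f i (x : R) := logker (e i) x * x `^ (- (2 + 1)).
have fv i := integral_logker _ (e0 i).
have fi i := integrable_logker _ (e0 i).
have [H1 H2] := integral_lincomb (fun i => - w i) _ _ fi fv.
have E : (fun x : R => ((\sum_i w i * cos (e i * x)) * x `^ (- (2 + 1)))%:E) =
   (fun x => (\sum_i - w i * f i x)%:E).
  apply/funext => x; congr EFin.
  transitivity ((\sum_i w i * cos (e i * x) - \sum_i w i
      + (\sum_i w i * e i ^+ 2) * (1 - cos (1 * x))) * x `^ (- (2 + 1))).
    by rewrite w0 we0 subr0 mul0r addr0.
  rewrite -sumrB [X in _ + X]mulr_suml -big_split/= mulr_suml.
  by apply: eq_bigr => i _; rewrite /f /logker; ring.
rewrite E; split => //; rewrite H2; congr EFin.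
by rewrite mulr_sumr; apply: eq_bigr => i _; ring.
Qed.

End cosine_sums.

(** * Integrals of odd and even functions over the line *)

Section symmetric_integrals.
Context {R : realType}.
Local Notation mu := (@lebesgue_measure R).
Local Notation Rp := (`]0%R, +oo[%classic : set R).

(* Also when the integral is undefined: [fine] sends [x - x] to 0 for every [x]. *)
Lemma Rintegral_odd (f : R -> R) : measurable_fun [set: R] f ->
  (forall x : R, f (- x) = - f x) -> Rintegral mu [set: R] f = 0.
Proof.
move=> mf fN; rewrite /Rintegral integralE.
have -> : (\int[mu]_x (fun x => (f x)%:E)^\- x = \int[mu]_x (fun x => (f x)%:E)^\+ x)%E.
  rewrite -[RHS]ge0_integral_reflect//; last first.
    by apply: measurable_funepos; apply/measurable_EFinP.
  apply: eq_integral => x _.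
  by rewrite funenegE funeposE fN EFinN.
case: (\int[mu]_x _)%E => [r| |] //=.
by rewrite subrr.
Qed.

Lemma ge0_integral_even (f : R -> \bar R) : measurable_fun [set: R] f ->
  (forall x, 0 <= f x)%E -> (forall x : R, 0 < x -> f (- x) = f x) ->
  (\int[mu]_x f x = 2%:E * \int[mu]_(x in Rp) f x)%E.
Proof.
move=> mf f0 fN; rewrite ge0_integral_fold//.
rewrite -ge0_integralZl_EFin//; last exact: measurable_funTS.
apply: eq_integral => x; rewrite inE/= in_itv/= andbT => x0.
by rewrite fN// mule_natl mule2n.
Qed.

(** The nonnegative case is applied to the positive and negative parts; integrability makes both
    finite, so their difference can be taken in the reals. *)
Lemma integral_even (f : R -> R) (v : R) : measurable_fun [set: R] f ->
  (forall x : R, 0 < x -> f (- x) = f x) ->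
  mu.-integrable Rp (fun x => (f x)%:E) -> (\int[mu]_(x in Rp) (f x)%:E = v%:E)%E ->
  Rintegral mu [set: R] f = 2 * v.
Proof.
move=> mf fN fi fv; rewrite /Rintegral.
have mfE : measurable_fun [set: R] (fun x => (f x)%:E) by apply/measurable_EFinP.
rewrite integralE !ge0_integral_even//; last 4 first.
- exact: measurable_funeneg.
- by move=> x x0; rewrite !funenegE fN.
- exact: measurable_funepos.
- by move=> x x0; rewrite !funeposE fN.
have Pf : (\int[mu]_(x in Rp) (fun x => (f x)%:E)^\+ x)%E \is a fin_num.
  exact: integrable_pos_fin_num.
have Nf : (\int[mu]_(x in Rp) (fun x => (f x)%:E)^\- x)%E \is a fin_num.
  exact: integrable_neg_fin_num.
move: fv; rewrite integralE.
move: Pf Nf; case: (\int[mu]_(x in _) _)%E => [a| |]// _.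
case: (\int[mu]_(x in _) _)%E => [b| |]// _.
by rewrite -EFinB => /(congr1 fine)/= <-; ring.
Qed.

End symmetric_integrals.

(** * The Fourier transform of a hat function *)

Section fourier_hat.
Context {R : realType}.
Local Notation mu := (@lebesgue_measure R).

(** [F] comes from one integration by parts. The phase [th] lets the same computation serve the real
    part ([th = 0]) and the imaginary part ([th = pi / 2]). *)
Lemma integral_affine_cos (a b p q xi th : R) : a < b -> xi != 0 ->
  let F t := (p + q * t) * sin (t * xi + th) / xi + q * cos (t * xi + th) / xi ^+ 2 in
  mu.-integrable `]a, b[ (fun t => ((p + q * t) * cos (t * xi + th))%:E) /\
  (\int[mu]_(t in `]a, b[) ((p + q * t) * cos (t * xi + th))%:E = (F b - F a)%:E)%E.
Proof.
move=> ab xi0 F.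
pose f (t : R) := (p + q * t) * cos (t * xi + th).
have dF (t : R) : is_derive t (1 : R) F (f t).
  rewrite /F /f; apply: is_derive_eq; rewrite /GRing.scale/= /GRing.scale/=.
  by field.
have cf : continuous f.
  move=> t; apply: cvgM.
    by apply: cvgD; [exact: cvg_cst|apply: cvgM; [exact: cvg_cst|exact: cvg_id]].
  apply: continuous_comp; last exact: continuous_cos.
  by apply: cvgD; [apply: cvgM; [exact: cvg_id|exact: cvg_cst]|exact: cvg_cst].
have mf : measurable_fun [set: R] f by exact: continuous_measurable_fun.
split.
  apply: (@integrableS _ _ _ mu `[a, b]%classic) => //.
    by apply: subset_itvW.
  apply: continuous_compact_integrable; first exact: segment_compact.
  exact: continuous_subspaceT.
rewrite -(@integral_itv_bndoo _ _ _ (EFin \o f) true false); last first.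
  by apply/measurable_EFinP; exact: measurable_funTS.
rewrite (@continuous_FTC2 R f F a b)//.
- exact: continuous_subspaceT.
- have cF : continuous F.
    by move=> t; apply/differentiable_continuous/derivable1_diffP.
  split=> [t _||].
  + exact: (@ex_derive _ _ _ _ _ _ _ (dF t)).
  + apply: cvg_at_right_filter; exact: cF.
  + apply: cvg_at_left_filter; exact: cF.
- by move=> t _; rewrite derive1E; have [] := dF t.
Qed.

Variable x : nat -> R.

(** The sine terms cancel because the two affine pieces agree at the middle node and vanish at the
    outer ones. What remains are the jumps of the slope, which are the entries of [cvec]. *)
Lemma integral_hat_cos (j : nat) (xi th : R) : x j.-1 < x j -> x j < x j.+1 -> xi != 0 ->
  Rintegral mu [set: R] (fun t => hat x j t * cos (t * xi + th)) =
  - (xi ^+ 2)^-1 * \sum_(p < 3) cvec x j 0 p * cos (x (j + p).-1 * xi + th).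
Proof.
move=> am mc xi0; set a := x j.-1 in am *; set m := x j in am mc *; set c := x j.+1 in mc *.
have h0 : 0 < h x j by rewrite /h subr_gt0.
have h1 : 0 < h x j.+1 by rewrite /h subr_gt0.
have [i1 e1] := @integral_affine_cos a m (- a / h x j) (h x j)^-1 xi th am xi0.
have [i2 e2] := @integral_affine_cos m c (c / h x j.+1) (- (h x j.+1)^-1) xi th mc xi0.
set f1 : R -> \bar R := (fun t : R => ((- a / h x j + (h x j)^-1 * t) * cos (t * xi + th))%:E) in i1 e1.
set f2 : R -> \bar R := (fun t : R => ((c / h x j.+1 + (- (h x j.+1)^-1) * t) * cos (t * xi + th))%:E) in i2 e2.
rewrite /Rintegral.
(* The equality holds at every point: at the node [m] both patches are 0, and so is [hat], which is
   defined by open intervals. *)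
have -> : (\int[mu]_t (hat x j t * cos (t * xi + th))%:E =
    \int[mu]_t ((f1 \_ `]a, m[) t + (f2 \_ `]m, c[) t))%E.
  apply: eq_integral => t _; rewrite !patchE.
  have -> : (t \in `]a, m[%classic) = (a < t) && (t < m) by rewrite mem_setE in_itv.
  have -> : (t \in `]m, c[%classic) = (m < t) && (t < c) by rewrite mem_setE in_itv.
  rewrite /hat -/a -/m -/c.
  case: ifPn => [/andP[_ tm]|_].
    rewrite [m < t]ltNge (ltW tm)/= adde0 /f1; congr EFin; field.
    by rewrite gt_eqF.
  case: ifPn => _; last by rewrite mul0r adde0.
  by rewrite add0e /f2; congr EFin; field; rewrite gt_eqF.
have i1' := (@integrable_mkcond _ (measurableTypeR R) R mu _ f1 (measurable_itv `]a, m[)).1 i1.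
have i2' := (@integrable_mkcond _ (measurableTypeR R) R mu _ f2 (measurable_itv `]m, c[)).1 i2.
rewrite integralD//.
rewrite -!integral_mkcond e1 e2 -EFinD /=.
rewrite !big_ord_recl big_ord0 /= !mxE /= addn0 addn1 addn2 /= -/a -/m -/c.
have hE : h x j = m - a by [].
have hE' : h x j.+1 = c - m by [].
rewrite hE hE'; rewrite hE in h0; rewrite hE' in h1.
move: (sin (a * xi + th)) (sin (m * xi + th)) (sin (c * xi + th))
  (cos (a * xi + th)) (cos (m * xi + th)) (cos (c * xi + th)) => sa sm sc ca cm cc.
by field; rewrite xi0 !gt_eqF.
Qed.

Local Open Scope complex_scope.

(** With [sisum], the real and the negated imaginary part of [sum_p c_p e^(- i x_p xi)]. *)
Definition cosum (j : nat) (xi : R) : R := \sum_(p < 3) cvec x j 0 p * cos (x (j + p).-1 * xi).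
Definition sisum (j : nat) (xi : R) : R := \sum_(p < 3) cvec x j 0 p * sin (x (j + p).-1 * xi).

Lemma fourier_hatE (j : nat) (xi : R) : x j.-1 < x j -> x j < x j.+1 -> xi != 0 ->
  fourier (hat x j) xi = ((Num.sqrt (2 * pi))^-1 * (xi ^+ 2)^-1)%:C *
    ((- cosum j xi) +i* sisum j xi).
Proof.
move=> am mc xi0; rewrite /fourier rmorphM/= -mulrA; congr (_ * _).
rewrite /cint; apply/eqP; rewrite eq_complex /=; apply/andP; split; apply/eqP.
- rewrite mul0r subr0 mulrN.
  have -> : (fun t : R => hat x j t * cos (- (t * xi)) - 0 * sin (- (t * xi))) =
      (fun t => hat x j t * cos (t * xi + 0)).
    by apply/funext => t; rewrite cosN addr0 mul0r subr0.
  rewrite integral_hat_cos// mulNr; congr (- (_ * _)).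
  by apply: eq_bigr => p _; rewrite addr0.
- rewrite mul0r addr0.
  have -> : (fun t : R => hat x j t * sin (- (t * xi)) + 0 * cos (- (t * xi))) =
      (fun t => hat x j t * cos (t * xi + pi / 2)).
    by apply/funext => t; rewrite sinN cosDpihalf mul0r addr0.
  rewrite integral_hat_cos// mulNr -mulrN -sumrN; congr (_ * _).
  by apply: eq_bigr => p _; rewrite cosDpihalf mulrN opprK.
Qed.

End fourier_hat.

(** * From the stiffness integral to a weighted cosine sum *)

Section stiffness.
Context {R : realType}.
Local Notation mu := (@lebesgue_measure R).
Local Notation Rp := (`]0%R, +oo[%classic : set R).
Local Open Scope complex_scope.
Variables (x : nat -> R) (j k : nat).
Hypotheses (xj : x j.-1 < x j) (xj1 : x j < x j.+1).
Hypotheses (xk : x k.-1 < x k) (xk1 : x k < x k.+1).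

Definition wgt (l l' : nat) (pq : 'I_3 * 'I_3) : R := cvec x l 0 pq.1 * cvec x l' 0 pq.2.
Definition dist (l l' : nat) (pq : 'I_3 * 'I_3) : R := d x (l + pq.1).-1 (l' + pq.2).-1.

(** [cvec] is a second difference and so annihilates affine functions: constants here, the identity
    in [cvec_sum1]. *)
Lemma cvec_sum (l : nat) : \sum_(p < 3) cvec x l 0 p = 0.
Proof. by rewrite !big_ord_recl big_ord0 !mxE /=; ring. Qed.

Lemma cvec_sum1 (l : nat) : x l.-1 < x l -> x l < x l.+1 ->
  \sum_(p < 3) cvec x l 0 p * x (l + p).-1 = 0.
Proof.
move=> l0 l1; rewrite !big_ord_recl big_ord0 !mxE /= addn0 addn1 addn2 /= /h /=.
by field; rewrite !subr_eq0 !gt_eqF.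
Qed.

Lemma sum_pair (f g : 'I_3 -> R) (F : 'I_3 * 'I_3 -> R) :
  (forall pq, F pq = f pq.1 * g pq.2) -> \sum_pq F pq = (\sum_p f p) * (\sum_q g q).
Proof.
move=> FE; rewrite big_distrlr /= pair_bigA /=.
by apply: eq_bigr => pq _; rewrite FE.
Qed.

Lemma wgt_sum : \sum_pq wgt j k pq = 0.
Proof. by rewrite (@sum_pair (cvec x j 0) (cvec x k 0))// cvec_sum mul0r. Qed.

(** Expanding [(X - Y)^2] gives three products of single sums, each with a factor in which [cvec]
    acts on a constant or on the identity. *)
Lemma wgt_sum2 : \sum_pq wgt j k pq * dist j k pq ^+ 2 = 0.
Proof.
pose X (l : nat) (p : 'I_3) := x (l + p).-1.
pose c (l : nat) (p : 'I_3) := cvec x l 0 p.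
transitivity (\sum_pq (c j pq.1 * X j pq.1 ^+ 2) * c k pq.2
  + \sum_pq (-2 * (c j pq.1 * X j pq.1)) * (c k pq.2 * X k pq.2)
  + \sum_pq c j pq.1 * (c k pq.2 * X k pq.2 ^+ 2)).
  rewrite -!big_split /=; apply: eq_bigr => pq _.
  by rewrite /wgt /dist /d real_normK ?num_real// -/(X _ _) -/(X _ _) /c; ring.
rewrite (@sum_pair (fun p => c j p * X j p ^+ 2) (c k))//.
rewrite (@sum_pair (fun p => -2 * (c j p * X j p)) (fun q => c k q * X k q))//.
rewrite (@sum_pair (c j) (fun q => c k q * X k q ^+ 2))//.
by rewrite !cvec_sum cvec_sum1// !mulr0 mul0r !addr0.
Qed.

(** The addition formula for [cos (u - v)]; evenness of the cosine turns differences of nodes into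
    distances. *)
Lemma cosum_prod (xi : R) :
  cosum x j xi * cosum x k xi + sisum x j xi * sisum x k xi =
  \sum_pq wgt j k pq * cos (dist j k pq * xi).
Proof.
rewrite /cosum /sisum !big_distrlr /= !pair_bigA /= -big_split /=.
apply: eq_bigr => pq _; rewrite /wgt /dist /d.
have -> (y : R) : cos (`|y| * xi) = cos (y * xi).
  by case: (ger0P y) => _ //; rewrite mulNr cosN.
rewrite mulrBl cosB; ring.
Qed.

Lemma quadratic_form (M : 'M[R]_3) :
  (cvec x j *m M *m (cvec x k)^T) 0 0 = \sum_pq wgt j k pq * M pq.1 pq.2.
Proof.
rewrite mxE.
transitivity (\sum_q \sum_p cvec x j 0 p * M p q * cvec x k 0 q).
  apply: eq_bigr => q _; rewrite [(_^T)%R q 0]mxE [(_ *m _) 0 q]mxE.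
  by rewrite big_distrl.
rewrite exchange_big pair_bigA /=; apply: eq_bigr => pq _.
by rewrite /wgt; ring.
Qed.

Variable s : R.
Hypothesis s0 : 0 < s.

Let P (xi : R) : R := `|xi| `^ (2 * s) * ((xi ^+ 2)^-1 * (xi ^+ 2)^-1).

Let A : R := (2 * pi)^-1.

Lemma stiffness_integrand (xi : R) :
  (`|xi| `^ (2 * s))%:C * fourier (hat x j) xi * conjc (fourier (hat x k) xi) =
  (A * ((\sum_pq wgt j k pq * cos (dist j k pq * xi)) * P xi)) +i*
  (A * ((cosum x j xi * sisum x k xi - sisum x j xi * cosum x k xi) * P xi)).
Proof.
have [->|xi0] := eqVneq xi 0.
  by rewrite /P normr0 powR0 ?mulf_neq0 ?gt_eqF// !mul0r !mulr0.
rewrite !fourier_hatE// -cosum_prod.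
set a := (Num.sqrt (2 * pi))^-1.
have aE : A = a * a.
  rewrite /A /a -invfM -expr2 sqr_sqrtr// mulr_ge0// ?pi_ge0//.
rewrite aE /P.
apply/eqP; rewrite eq_complex /=; apply/andP; split; apply/eqP; ring.
Qed.

Lemma P_pos (xi : R) : 0 < xi -> P xi = xi `^ (- (3 - 2 * s + 1)).
Proof.
move=> xi0; rewrite /P gtr0_norm//.
have -> : - (3 - 2 * s + 1) = 2 * s - 4%:R by ring.
rewrite powRB ?(gt_eqF xi0) ?implybT// powR_mulrn ?(ltW xi0)//.
by rewrite -invfM -exprD.
Qed.

(** The imaginary part of the integrand is odd and contributes 0. The real part is even, and
    doubling the half-line integral turns the prefactor [1 / (2 pi)] into [1 / pi]. *)
Lemma stiffnessE (V : R) :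
  mu.-integrable Rp (fun xi => ((\sum_pq wgt j k pq * cos (dist j k pq * xi)) *
     xi `^ (- (3 - 2 * s + 1)))%:E) ->
  (\int[mu]_(xi in Rp) ((\sum_pq wgt j k pq * cos (dist j k pq * xi)) *
     xi `^ (- (3 - 2 * s + 1)))%:E = V%:E)%E ->
  S x s j k = (pi^-1 * V)%:C.
Proof.
move=> iV eV.
have mP : measurable_fun [set: R] P by rewrite /P; meas.
have msum (I : finType) (w e : I -> R) (f : R -> R) : measurable_fun [set: R] f ->
    measurable_fun [set: R] (fun xi => \sum_i w i * f (e i * xi)).
  move=> mf; apply: measurable_sum => i; apply: measurable_funM => //.
  by apply: (measurableT_comp mf); meas.
have mcos : measurable_fun [set: R] (@cos R) by apply: continuous_measurable_fun; exact: continuous_cos.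
have msin : measurable_fun [set: R] (@sin R) by apply: continuous_measurable_fun; exact: continuous_sin.
have PN (xi : R) : P (- xi) = P xi by rewrite /P normrN sqrrN.
rewrite /S.
have -> : (fun xi => (`|xi| `^ (2 * s))%:C * fourier (hat x j) xi * conjc (fourier (hat x k) xi)) =
   (fun xi => (A * ((\sum_pq wgt j k pq * cos (dist j k pq * xi)) * P xi)) +i*
  (A * ((cosum x j xi * sisum x k xi - sisum x j xi * cosum x k xi) * P xi))).
  by apply/funext => xi; rewrite stiffness_integrand.
rewrite /cint; apply/eqP; rewrite eq_complex /=; apply/andP; split; apply/eqP; last first.
  apply: Rintegral_odd.
    apply: measurable_funM => //; apply: measurable_funM => //.
    by apply: measurable_funB; apply: measurable_funM; apply: msum.
  move=> xi; rewrite PN.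
  have cN l : cosum x l (- xi) = cosum x l xi.
    by apply: eq_bigr => p _; rewrite mulrN cosN.
  have sN l : sisum x l (- xi) = - sisum x l xi.
    by rewrite /sisum -sumrN; apply: eq_bigr => p _; rewrite mulrN sinN mulrN.
  by rewrite !cN !sN; ring.
have -> : pi^-1 * V = 2 * (A * V).
  by rewrite /A invfM !mulrA divff ?mul1r.
apply: integral_even.
- apply: measurable_funM => //; apply: measurable_funM => //.
  exact: msum.
- move=> xi _; rewrite PN; congr (_ * (_ * _)).
  by apply: eq_bigr => p _; rewrite mulrN cosN.
- have : mu.-integrable Rp (fun xi => (A%:E *
      ((\sum_pq wgt j k pq * cos (dist j k pq * xi)) * xi `^ (- (3 - 2 * s + 1)))%:E)%E).
    exact: integrableZl.
  apply: eq_integrable => // xi; rewrite inE/= in_itv/= andbT => xi0.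
  by rewrite -EFinM P_pos.
- rewrite EFinM -eV -integralZl//.
  apply: eq_integral => xi; rewrite inE/= in_itv/= andbT => xi0.
  by rewrite -EFinM P_pos.
Qed.

End stiffness.

(** * The entries on an arbitrary mesh, in the power and the logarithmic case *)

Local Open Scope complex_scope.

Theorem theorem2p1 (R : realType) (a b : R) (N : nat) (x : nat -> R) (s : R)
    (j k : nat) :
  a < b -> (2 <= N)%N ->
  x 0%N = a -> x N = b -> (forall l : nat, (l < N)%N -> x l < x l.+1) ->
  (1 <= j <= N.-1)%N -> (1 <= k <= N.-1)%N ->
  0 < s < 3 / 2 ->
  (s != 1 / 2 ->
     S x s j k
     = (Chat s * (cvec x j *m Dmx x (3 - 2 * s) j k *m (cvec x k)^T) 0 0)%:C)
  /\
  (s = 1 / 2 ->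
     S x s j k = ((2 * pi)^-1 * (cvec x j *m Emx x j k *m (cvec x k)^T) 0 0)%:C).
Proof.
move=> ab N2 xa xb xlt /andP[j1 jN] /andP[k1 kN] /andP[s0 s32].
have node l : (1 <= l <= N.-1)%N -> x l.-1 < x l /\ x l < x l.+1.
  case: l => [//|l] /andP[_ lN]; have lN' : (l.+1 < N)%N.
    by case: N N2 lN {xb xlt jN kN} => // n _; rewrite ltnS.
  by split; apply: xlt => //; exact: ltnW.
have [xj xj1] := node j (introT andP (conj j1 jN)).
have [xk xk1] := node k (introT andP (conj k1 kN)).
have e0 pq : 0 <= dist x j k pq by exact: normr_ge0.
have w0 := wgt_sum x j k.
have w2 := wgt_sum2 x j k xk xk1.
split=> [sn|sE].
  have g03 : 0 < 3 - 2 * s < 3 by apply/andP; split; lra.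
  have gn2 : 3 - 2 * s != 2.
    by apply: contra sn => /eqP g2; apply/eqP; lra.
  have [iV eV] := cosine_sum_integral _ _ _ _ g03 gn2 e0 w0 w2.
  rewrite (stiffnessE x j k xj xj1 xk xk1 s s0 _ iV eV); congr (_%:C).
  rewrite quadratic_form /Chat.
  have -> : \sum_pq wgt x j k pq * Dmx x (3 - 2 * s) j k pq.1 pq.2 =
      \sum_pq wgt x j k pq * dist x j k pq `^ (3 - 2 * s).
    by apply: eq_bigr => pq _; rewrite mxE.
  have -> : 4 - 2 * s = 3 - 2 * s + 1 by ring.
  (* By [mellin_cstB2] the left side is the constant at [1 - 2 s], and
     [sin (pi / 2 - s pi) = cos (s pi)]. *)
  have -> : - mellin_cst (3 - 2 * s) = pi / 2 / cos (s * pi).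
    rewrite -mellin_cstB2 /mellin_cst.
    have -> : pi / 2 * (3 - 2 * s - 2) = - (s * pi - pi / 2).
      have -> : 3 - 2 * s - 2 = 1 - s * 2 by ring.
      by rewrite mulrBr mulr1 (mulrC s) mulrA divfK// opprB (mulrC s).
    by rewrite sinN sinBpihalf opprK.
  move: (cos (s * pi)) (Defs.Gamma _) (\sum_pq _) => c G X.
  have pn0 : (pi : R) != 0 by rewrite gt_eqF// pi_gt0.
  move: (pi) pn0 => p pn0.
  by rewrite !invfM; move: c^-1 G^-1 => ci Gi; field.
have [iV eV] := cosine_sum_integral_log _ _ _ e0 w0 w2.
have gE : 3 - 2 * s = 2 by rewrite sE; field.
have := stiffnessE x j k xj xj1 xk xk1 s s0; rewrite gE => /(_ _ iV eV) ->.
congr (_%:C); rewrite quadratic_form.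
have -> : \sum_pq wgt x j k pq * Emx x j k pq.1 pq.2 =
   \sum_pq wgt x j k pq * (if dist x j k pq == 0 then 0
      else dist x j k pq ^+ 2 * ln (dist x j k pq)).
  by apply: eq_bigr => pq _; rewrite mxE.
by rewrite mulrA invfM (mulrC 2^-1).
Qed.
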